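(* Let $\xi\in\mathbb{R}$ satisfy $\xi=G(\xi)$. The $0$th-order mode of the linearization of the nonlinear Fokker-Planck equation around the stationary state $\rho_\xi$ is stable if and only if $G'(\xi)<1$.
   Context: $L>0$ and $\sigma>0$ are constants; $[0,L]$ is regarded as a torus, with $\|x\|=\min(|x|,L-|x|)$. $G:\mathbb{R}\to\mathbb{R}$ is an odd smooth function. $\phi$ is a nonnegative influence function with $\frac{1}{L}\int_0^L\phi(\|x\|)\,dx=1$. The nonlinear Fokker-Planck equation is $$\frac{\partial \rho}{\partial t} = - u\frac{\partial \rho}{\partial x} - \frac{\partial}{\partial u}\left\{\left[G\left(\int_0^L\int_{-\infty}^\infty u'\phi(\|x'\|) \rho(t,x-x',u') du'dx' \right) - u \right] \rho\right\} + \frac{1}{2} \sigma^2 \frac{\partial^2 \rho}{\partial u^2},$$ periodic in $x$. For $\xi=G(\xi)$ it has the stationary state $\rho_\xi(x,u)=\frac1L F_\xi(u)$, $F_\xi(u)=\frac{1}{\sqrt{\pi\sigma^2}}\exp(-(u-\xi)^2/\sigma^2)$. Linearizing with $\rho=\rho_\xi+\rho^{(1)}$ and expanding the perturbation as $\rho^{(1)}(t,x,u)=\sum_{k\in\mathbb{Z}}\rho^{(1)}_k(t,u)e^{-i2\pi kx/L}$ gives uncoupled equations; the $0$th-order mode satisfies $$\frac{\partial\rho_0^{(1)}}{\partial t} = -\frac{\partial}{\partial u}\left[(\xi-u) \rho_0^{(1)}\right] - G'(\xi)\left[\int_{-\infty}^\infty u'\rho_0^{(1)}(t,u')du'\right]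 F'_\xi(u) + \frac{1}{2} \sigma^2 \frac{\partial^2 \rho_0^{(1)}}{\partial u^2}.$$ Let $\hat\rho_0^{(1)}(t,\eta)=\int_{-\infty}^\infty\rho_0^{(1)}(t,u)e^{-i\eta u}du$. Initial conditions are assumed to satisfy $\|\hat\rho_0^{(1)}(0,\cdot)\|_{L^1}+\|\hat\rho_0^{(1)}(0,\cdot)\|_{L^\infty}+\|\partial_\eta\hat\rho_0^{(1)}(0,\cdot)\|_{L^\infty}<\infty$. The $0$th-order mode is called stable if (for such initial conditions) $$\sup_{t\ge0}\big\{\|\hat\rho_0^{(1)}(t,\cdot)\|_{L^1}+\|\hat\rho_0^{(1)}(t,\cdot)\|_{L^\infty}+\|\partial_\eta\hat\rho_0^{(1)}(t,\cdot)\|_{L^\infty}\big\}<\infty.$$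
   Formalization: The case ξ = 0 with G'(0) = 1 is excluded: there (e.g. G(u) = u) the first moment is constant in time and the 0th-order mode is stable although G'(ξ) < 1 fails, so the claimed equivalence is false. *)

(* Defs.v *)
(* World: MathComp, with MathComp-Analysis and R[i] from real-closed. *)
From HB Require Import structures.
From mathcomp Require Import all_boot all_order all_algebra.
From mathcomp Require Import all_classical all_reals all_analysis.
From mathcomp Require Import complex.

Set Implicit Arguments.
Unset Strict Implicit.
Unset Printing Implicit Defensive.

Import Order.TTheory GRing.Theory Num.Theory.
Import numFieldNormedType.Exports.

Local Open Scope ring_scope.
Local Open Scope complex_scope.
Local Open Scope classical_set_scope.

Section Defs.
Context {R : realType}.
Implicit Types (f G : R -> R) (rho : R -> R -> R) (sigma xi t u : R).

Local Notation mu := (@lebesgue_measure R).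

Definition smooth f := forall (n : nat) (x : R), derivable (derive1n n f) x 1.

Definition Maxwellian sigma xi u : R :=
  (Num.sqrt (pi * sigma ^+ 2))^-1 * expR (- (u - xi) ^+ 2 / sigma ^+ 2).

Definition first_moment f : R := (\int[mu]_u (u * f u))%R.

(* Linearized equation for the mean over the torus of the perturbation. The
   length L and the influence function phi do not occur: the mean of phi is 1. *)
Definition zeroth_mode_equation sigma G xi rho t u : Prop :=
  derive1 (fun s => rho s u) t =
    - derive1 (fun v => (xi - v) * rho t v) u
    - derive1 G xi * first_moment (rho t) * derive1 (Maxwellian sigma xi) u
    + 2^-1 * sigma ^+ 2 * derive1n 2 (rho t) u.

(* rho is of class C^{1,2} on ]0, +oo[ x R. *)
Definition C12 rho : Prop := forall t u, 0 < t ->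
  [/\ derivable (fun s => rho s u) t 1,
      derivable (rho t) u 1 &
      derivable (derive1 (rho t)) u 1] /\
  [/\ {for (t, u), continuous (fun p : R * R => derive1 (fun s => rho s p.2) p.1)},
      {for (t, u), continuous (fun p : R * R => derive1 (rho p.1) p.2)} &
      {for (t, u), continuous (fun p : R * R => derive1n 2 (rho p.1) p.2)}].

(* t |-> rho t is continuous from [0, +oo[ to L^1((1 + |u|) du). This is what
   gives a meaning to the first moment and to the Fourier transform at every
   t >= 0, and to rho 0 as the initial condition. *)
Definition weighted_L1_continuous rho : Prop := forall t, 0 <= t ->
  mu.-integrable setT (EFin \o (fun u => (1 + `|u|) * rho t u)) /\
  (\int[mu]_u ((1 + `|u|) * `|rho s u - rho t u|))%R
    @[s --> within [set s : R | 0 <= s] (nbhs t)] --> (0 : R).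

(* Only the values of rho at times t >= 0 matter. *)
Definition zeroth_mode_solution sigma G xi rho : Prop :=
  [/\ C12 rho,
      weighted_L1_continuous rho &
      forall t u, 0 < t -> zeroth_mode_equation sigma G xi rho t u].

(* \int f(u) e^{- i eta u} du, for a real-valued f. *)
Definition fourier f (eta : R) : R[i] :=
  (\int[mu]_u (f u * cos (eta * u)))%R -i* (\int[mu]_u (f u * sin (eta * u)))%R.

(* Derivative of a complex-valued function of a real variable. *)
Definition cderive1 (h : R -> R[i]) (eta : R) : R[i] :=
  derive1 (fun x => complex.Re (h x)) eta +i* derive1 (fun x => complex.Im (h x)) eta.

Definition cLnorm (p : \bar R) (h : R -> R[i]) : \bar R :=
  ('N[mu]_p [ EFin \o (@ComplexField.Normc.normc R \o h) ])%E.

Definition fourier_norm f : \bar R :=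
  (cLnorm 1 (fourier f) + cLnorm +oo (fourier f)
   + cLnorm +oo (cderive1 (fourier f)))%E.

(* The initial conditions are not required to have zero mass. At the single
   point xi = 0, G'(0) = 1, the first moment of a solution is constant in time
   and every solution stays bounded, although G'(xi) < 1 fails. *)
Definition zeroth_mode_stable sigma G xi : Prop :=
  forall rho, zeroth_mode_solution sigma G xi rho ->
    (fourier_norm (rho 0%R) < +oo)%E ->
    (ereal_sup [set fourier_norm (rho t) | t in [set t : R | (0 <= t)%R]]
       < +oo)%E.

End Defs.

(* Main.v *)
Require Import Defs.
From HB Require Import structures.
From mathcomp Require Import all_boot all_order all_algebra.
From mathcomp Require Import all_classical all_reals all_analysis.
From mathcomp Require Import complex.
From mathcomp Require Import measurable_realfun ess_sup_inf ring lra.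

(** Write [a = G'(xi)], [k = sigma^2 / 4], and let [m(t)] be the first moment
    of a solution [rho]. On the Fourier side the equation is of first order: it
    transports frequencies along [eta(t) = w e^t], damps them, and feels the
    source only through [m]. Along a characteristic it can therefore be
    integrated, and everything is read off the resulting formula
    ([transform_evolution], solved for the transform in [solution_formula]):
    up to a phase, the transform of [rho t] at [eta] is
<<
      e^(- k (1 - e^(-2t)) eta^2) * (transform of rho 0 at eta e^(-t))
        - a * (e^(-t) * P t) * eta * e^(- k eta^2),
>>
    where [P t] is the integral of [m(s) e^s] over [0, t].

    The solutions are only of class C^{1,2} for positive time, with a
    continuous path in the weighted L^1 space; nothing is known about the decay
    of their derivatives in [u]. So the formula is proved by duality. The waves
    [e^(k w(s)^2) cos (w(s) (u - xi) + th)], with [w(s) = w e^s], solve the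
    backward adjoint equation. They are multiplied by a polynomial taper on
    [[xi - r, xi + r]] that vanishes to second order at the two ends; there
    Green's formula has no boundary terms ([is_derive_windowed]), and the
    commutator of the taper with the adjoint operator is [O((1 + |u|) / r)],
    uniformly in time ([taper_error_le]). The mean value theorem and
    [r -> +oo] give the identity. Working with the cosine and an arbitrary
    constant phase [th] treats the real and the imaginary part at once.

    The derivative at frequency zero of the same identity is the moment
    equation [P' = a P + g] with [g = O(e^t)] ([first_moment_evolution]). If
    [a < 1], a comparison argument bounds [e^(-t) P t] ([impulse_le]), and each
    of the three norms is bounded uniformly in time. The L^1 norm needs two
    regimes: for [t <= 1] the dilation by [e^(-t)] costs at most a factor [e],
    and for [t >= 1] the Gaussian damping is itself integrable, uniformly in
    [t].

    Conversely, the span of the Maxwellian [F] and of [F'] is invariant: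
    [alpha F + beta F'] is a solution when [beta' = (a - 1) beta - a alpha xi].
    If [a > 1], take [alpha = 0] and [beta = e^((a - 1) t)]; if [a = 1], then
    [xi] is not zero, and [alpha = 1], [beta = - xi t] will do. The L^1 norm of
    the transform dominates a multiple of [|beta|], which is unbounded
    ([not_stable_of_unbounded]). *)

Import Order.TTheory GRing.Theory Num.Theory.
Import numFieldNormedType.Exports.

Local Open Scope ring_scope.
Local Open Scope classical_set_scope.

Set Implicit Arguments.
Unset Strict Implicit.
Unset Printing Implicit Defensive.

(** * Integrability against the weight 1 + |u| *)

Definition wint {R : realType} (f : R -> R) : Prop :=
  (@lebesgue_measure R).-integrable setT (EFin \o (fun u => (1 + `|u|) * f u)).

Definition wnorm {R : realType} (f : R -> R) : R :=
  (\int[@lebesgue_measure R]_u ((1 + `|u|) * `|f u|))%R.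

Section WeightedL1.
Context {R : realType}.
Local Notation mu := (@lebesgue_measure R).
Implicit Types (f g h : R -> R).

Lemma weight_gt0 (u : R) : 0 < 1 + `|u|.
Proof. by rewrite ltr_wpDr. Qed.

Lemma measurable_weight : measurable_fun setT (fun u : R => 1 + `|u|).
Proof.
apply: continuous_measurable_fun => u.
by apply: cvgD; [exact: cvg_cst|exact: norm_continuous].
Qed.

Lemma wint_measurable f : wint f -> measurable_fun setT f.
Proof.
move=> /(measurable_int mu)/measurable_EFinP mf.
have -> : f = (fun u => ((1 + `|u|) * f u) * (1 + `|u|)^-1).
  apply/funext => u; have w0 : 1 + `|u| != 0 by rewrite gt_eqF ?weight_gt0.
  by rewrite mulrAC mulfV ?mul1r.
apply: measurable_funM => //.
apply: continuous_measurable_fun => u.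
apply: cvgV; first by rewrite gt_eqF// weight_gt0.
by apply: cvgD; [exact: cvg_cst|exact: norm_continuous].
Qed.

Lemma wint_norm f : wint f ->
  mu.-integrable setT (EFin \o (fun u => (1 + `|u|) * `|f u|)).
Proof.
move=> /integrable_norm; apply: eq_integrable => // u _ /=.
by rewrite normrM ger0_norm // ltW // weight_gt0.
Qed.

Lemma wnorm_ge0 f : 0 <= wnorm f.
Proof. by apply: Rintegral_ge0 => u _; rewrite mulr_ge0// ltW// weight_gt0. Qed.

Lemma wintM f h (K : R) : wint f -> measurable_fun setT h ->
  (forall u, `|h u| <= K * (1 + `|u|)) ->
  mu.-integrable setT (EFin \o (fun u => f u * h u)).
Proof.
move=> fi mh hK; have mf := wint_measurable fi.
apply: (@le_integrable _ _ _ mu _ measurableT _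
         (EFin \o (fun u => K * ((1 + `|u|) * `|f u|)))).
- by apply/measurable_EFinP; exact: measurable_funM.
- move=> u _ /=; rewrite lee_fin normrM.
  have K0 : 0 <= K.
    have /le_trans := normr_ge0 (h 0); move=> /(_ _ (hK 0)).
    by rewrite normr0 addr0 mulr1.
  rewrite [leRHS]ger0_norm; last first.
    by rewrite !mulr_ge0// ltW// weight_gt0.
  by rewrite mulrA mulrC ler_wpM2r.
- exact: (integrableZl measurableT K (wint_norm fi)).
Qed.

(** The weighted L^1 norm controls pairings with functions of at most linear
    growth; all pairings of a solution with a test function are estimated
    through it. *)
Lemma wintM_le f h (K : R) : wint f -> measurable_fun setT h ->
  (forall u, `|h u| <= K * (1 + `|u|)) ->
  `|\int[mu]_u (f u * h u)| <= K * wnorm f.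
Proof.
move=> fi mh hK; have fhi := wintM fi mh hK.
apply: le_trans (le_normr_Rintegral measurableT fhi) _.
rewrite /wnorm -RintegralZl//; last exact: wint_norm.
apply: le_Rintegral => //.
- exact: (integrable_norm fhi).
- exact: (integrableZl measurableT K (wint_norm fi)).
- by move=> u _; rewrite normrM mulrA mulrC ler_wpM2r.
Qed.

Lemma wintB f g : wint f -> wint g -> wint (fun u => f u - g u).
Proof.
move=> fi gi; have := integrableB measurableT fi gi.
by apply: eq_integrable => // u _ /=; rewrite -EFinB mulrBr.
Qed.

Lemma wintZ f (k : R) : wint f -> wint (fun u => k * f u).
Proof.
move=> /(integrableZl measurableT k); apply: eq_integrable => // u _ /=.
by rewrite -EFinM mulrCA.
Qed.

Lemma wintD f g : wint f -> wint g -> wint (fun u => f u + g u).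
Proof.
move=> fi gi; have := integrableD measurableT fi gi.
by apply: eq_integrable => // u _ /=; rewrite -EFinD mulrDr.
Qed.

Lemma wnormD f g : wint f -> wint g ->
  wnorm (fun u => f u + g u) <= wnorm f + wnorm g.
Proof.
move=> fi gi; rewrite /wnorm -RintegralD//; try exact: wint_norm.
apply: le_Rintegral => //.
- exact/wint_norm/wintD.
- exact: (integrableD measurableT (wint_norm fi) (wint_norm gi)).
- move=> u _; rewrite -mulrDr ler_pM2l ?weight_gt0//; exact: ler_normD.
Qed.

Lemma wnormZ f (k : R) : wint f -> wnorm (fun u => k * f u) = `|k| * wnorm f.
Proof.
move=> fi; rewrite /wnorm -RintegralZl//; last exact: wint_norm.
by apply: eq_Rintegral => u _; rewrite normrM mulrCA.
Qed.

End WeightedL1.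

(** * Continuity in time of pairings with a solution *)

Section TimeContinuity.
Context {R : realType}.
Local Notation mu := (@lebesgue_measure R).
Local Notation nneg t := (within [set s : R | 0 <= s] (nbhs t)).
Variable rho : R -> R -> R.
Hypothesis rho_cont : weighted_L1_continuous rho.

Lemma wint_time t : 0 <= t -> wint (rho t).
Proof. by move=> /rho_cont[]. Qed.

Lemma wnorm_sub_cvg t : 0 <= t ->
  wnorm (fun u => rho s u - rho t u) @[s --> nneg t] --> (0 : R).
Proof. by move=> /rho_cont[]. Qed.

(** The pairing of a time-dependent solution with a time-dependent test
    function moves continuously: the difference splits into a variation of the
    solution, measured by the weighted norm, and a variation of the test
    function, measured by [delta]. *)
Lemma pairing_cvg (h : R -> R -> R) (delta : R -> R) (K t : R) : 0 <= t ->
  (forall s, measurable_fun setT (h s)) ->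
  (forall u, `|h t u| <= K * (1 + `|u|)) ->
  (forall s u, 0 <= s -> `|h s u - h t u| <= delta s * (1 + `|u|)) ->
  delta s @[s --> nneg t] --> (0 : R) ->
  (\int[mu]_u (rho s u * h s u))%R @[s --> nneg t]
    --> (\int[mu]_u (rho t u * h t u))%R.
Proof.
move=> t0 mh hK hd d0.
have hsK s u : 0 <= s -> `|h s u| <= (K + delta s) * (1 + `|u|).
  move=> s0; have -> : h s u = h t u + (h s u - h t u) by rewrite addrC subrK.
  by rewrite mulrDl; apply: le_trans (ler_normD _ _) (lerD (hK u) (hd s u s0)).
apply/subr_cvg0.
pose b s := (K + delta s) * wnorm (fun u => rho s u - rho t u)
            + delta s * wnorm (rho t).
have b0 : b s @[s --> nneg t] --> (K + 0) * 0 + 0 * wnorm (rho t).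
  apply: cvgD; last by apply: cvgM => //; exact: cvg_cst.
  apply: cvgM; last exact: wnorm_sub_cvg.
  by apply: cvgD => //; exact: cvg_cst.
rewrite mulr0 mul0r addr0 in b0.
have Nb0 : - b s @[s --> nneg t] --> - (0 : R) by exact: cvgN.
rewrite oppr0 in Nb0.
apply: (squeeze_cvgr _ Nb0 b0).
rewrite near_withinE; apply: nearW => s /= s0.
rewrite -ler_norml.
have id : wint (fun u => rho s u - rho t u) by apply: wintB; exact: wint_time.
have mhd : measurable_fun setT (fun u => h s u - h t u) by exact: measurable_funB.
have -> : (\int[mu]_u (rho s u * h s u) - \int[mu]_u (rho t u * h t u) =
  \int[mu]_u ((rho s u - rho t u) * h s u) + \int[mu]_u (rho t u * (h s u - h t u)))%R.
  rewrite -RintegralB//; last 2 first.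
  - exact: (wintM (wint_time s0) (mh s) (fun u => hsK s u s0)).
  - exact: (wintM (wint_time t0) (mh t) hK).
  rewrite -RintegralD//.
  - by apply: eq_Rintegral => u _; ring.
  - exact: (wintM id (mh s) (fun u => hsK s u s0)).
  - exact: (wintM (wint_time t0) mhd (fun u => hd s u s0)).
apply: le_trans (ler_normD _ _) _; apply: lerD.
- exact: (wintM_le id (mh s) (fun u => hsK s u s0)).
- exact: (wintM_le (wint_time t0) mhd (fun u => hd s u s0)).
Qed.

Lemma nneg_cvg_within (f : R -> R) (T : R) :
  (forall t : R, 0 <= t -> f s @[s --> nneg t] --> f t) -> {within `[0, T], continuous f}.
Proof.
move=> cf; apply/subspace_continuousP => t /=; rewrite in_itv/= => /andP[t0 tT].
apply: cvg_trans (cf t t0); apply: cvg_app; apply: within_subset => s /=.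
by rewrite in_itv/= => /andP[].
Qed.

(** The weighted norm is continuous in time, hence bounded on compact time
    intervals. *)
Lemma wnorm_bounded (T : R) : exists C, forall s, 0 <= s <= T -> wnorm (rho s) <= C.
Proof.
have [T0|T0] := ltP T 0.
  by exists 0 => s /andP[s0 sT]; have := le_lt_trans (le_trans s0 sT) T0; rewrite ltxx.
have cN : {within `[0, T], continuous (fun s => wnorm (rho s))}.
  apply: nneg_cvg_within => t t0.
  apply/subr_cvg0.
  have b0 := wnorm_sub_cvg t0.
  have Nb0 : - wnorm (fun u => rho s u - rho t u) @[s --> nneg t] --> - (0 : R).
    exact: cvgN.
  rewrite oppr0 in Nb0.
  apply: (squeeze_cvgr _ Nb0 b0).
  rewrite near_withinE; apply: nearW => s /= s0.
  rewrite -ler_norml ler_norml.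
  have ws := wint_time s0; have wt := wint_time t0.
  have := wnormD (wintB ws wt) wt.
  have := wnormD (wintB wt ws) ws.
  have -> : (fun u => rho t u - rho s u + rho s u) = rho t.
    by apply/funext => u; rewrite subrK.
  have -> : (fun u => rho s u - rho t u + rho t u) = rho s.
    by apply/funext => u; rewrite subrK.
  have -> : wnorm (fun u => rho t u - rho s u) = wnorm (fun u => rho s u - rho t u).
    by apply: eq_Rintegral => u _; rewrite distrC.
  by move=> ? ?; apply/andP; split; lra.
have [c _ cmax] := EVT_max T0 cN.
by exists (wnorm (rho c)) => s s0T; apply: cmax; rewrite in_itv.
Qed.

End TimeContinuity.

(** * Differentiation and integration over bounded intervals *)

Section IntervalCalculus.
Context {R : realType}.
Local Notation mu := (@lebesgue_measure R).

Lemma MVT_le (g dg : R -> R) (a b M : R) : a <= b ->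
  (forall x, a < x < b -> is_derive x 1 g (dg x)) ->
  {within `[a, b], continuous g} ->
  (forall x, a < x < b -> `|dg x| <= M) ->
  `|g b - g a| <= M * (b - a).
Proof.
rewrite le_eqVlt => /predU1P[->|ab] dgP cg dgM; first by rewrite !subrr normr0 mulr0.
have dgP' x : x \in `]a, b[%R -> is_derive x 1 g (dg x) by rewrite in_itv; exact: dgP.
have [c cab ->] := MVT ab dgP' cg.
have ba : 0 <= b - a by rewrite subr_ge0 ltW.
rewrite normrM [`|b - a|]ger0_norm// ler_wpM2r//.
by apply: dgM; move: cab; rewrite in_itv.
Qed.

Lemma is_derive_continuous (g : R -> R) (x dg : R) :
  is_derive x 1 g dg -> {for x, continuous g}.
Proof.
by move=> H; apply/differentiable_continuous/derivable1_diffP; exact: ex_derive.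
Qed.

(** Only partial derivatives are assumed continuous in both variables, yet
    integrands involve the function itself: near a point the time derivative is
    bounded, so the function is Lipschitz in time uniformly in space, and
    continuity in space finishes. *)
Lemma joint_continuity (p dp : R -> R -> R) (t u : R) : 0 < t ->
  (forall s v : R, 0 < s -> is_derive s 1 (p ^~ v) (dp s v)) ->
  {for (t, u), continuous (fun q : R * R => dp q.1 q.2)} ->
  {for u, continuous (p t)} ->
  {for (t, u), continuous (fun q : R * R => p q.1 q.2)}.
Proof.
move=> t0 pd cdp cp.
have [e /= e0 dpM] : exists2 e : R, 0 < e & forall s v : R, ball t e s -> ball u e v ->
    0 < s /\ `|dp s v| <= `|dp t u| + 1.
  (* A box around (t, u) on which time stays positive and the time derivative
     is bounded. *)
  have : \forall q \near (t, u), `|dp q.1 q.2| <= `|dp t u| + 1.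
    have := cvgr_norm_le _ cdp; apply; by rewrite ltrDl.
  move=> /nbhs_ballP[e1 e10 H].
  have [e2 e20 H2] : exists2 e, 0 < e & ball t e `<=` [set s | 0 < s].
    by have /nbhs_ballP[e ? ?] := lt_nbhsr t0; exists e.
  exists (Num.min e1 e2); first by rewrite lt_min e10 e20.
  move=> s v sb vb; split.
    by apply: H2; apply: le_ball sb; rewrite ge_min lexx orbT.
  apply: (H (s, v)); split => /=.
    by apply: le_ball sb; rewrite ge_min lexx.
  by apply: le_ball vb; rewrite ge_min lexx.
pose M : R := `|dp t u| + 1.
have M0 : 0 < M by rewrite ltr_wpDl.
have mv (s v : R) : ball t e s -> ball u e v -> `|p s v - p t v| <= M * `|s - t|.
  move=> sb vb.
  have tb : ball t e t by exact: ballxx.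
  have seg (x y z : R) : ball t e x -> ball t e y -> x <= z <= y -> ball t e z.
    rewrite /ball /= !ltr_distl => /andP[? ?] /andP[? ?] /andP[? ?].
    by apply/andP; split; lra.
  have lip (x y : R) : ball t e x -> ball t e y -> x <= y ->
      `|p y v - p x v| <= M * (y - x).
    move=> xb yb xy; apply: (@MVT_le (p ^~ v) (dp ^~ v)) => //.
    - move=> z /andP[xz zy]; apply: pd.
      by have [] := dpM z v (seg _ _ z xb yb _) vb; rewrite ?(ltW xz) ?(ltW zy).
    - apply: continuous_in_subspaceT => z; rewrite inE/= in_itv/= => xzy.
      apply: (@is_derive_continuous _ _ (dp z v)); apply: pd.
      by have [] := dpM z v (seg _ _ z xb yb xzy) vb.
    - move=> z /andP[xz zy].
      by have [] := dpM z v (seg _ _ z xb yb _) vb; rewrite ?(ltW xz) ?(ltW zy).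
  have [st|ts] := leP s t.
    rewrite distrC [`|s - t|]distrC [`|t - s|]ger0_norm ?subr_ge0//.
    exact: lip.
  by rewrite [X in _ <= _ * X]ger0_norm ?subr_ge0; [apply: lip => //|]; exact: ltW.
apply/cvgrPdist_le => /= eps eps0.
have [d /= d0 dP] : exists2 d : R, 0 < d & forall v, ball u d v -> `|p t u - p t v| <= eps / 2.
  have /cvgrPdist_le /(_ (eps / 2)) := cp; rewrite divr_gt0// => /(_ isT).
  by move=> /nbhs_ballP[d d0 dP]; exists d.
pose r := Num.min e (Num.min d (eps / 2 / M)).
have r0 : 0 < r by rewrite !lt_min e0 d0 !divr_gt0.
exists (ball t r, ball u r); first by split; exact: nbhsx_ballx.
move=> -[s v] [/= sb vb].
have -> : p t u - p s v = (p t u - p t v) - (p s v - p t v) by ring.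
apply: le_trans (ler_normB _ _) _.
have -> : eps = eps / 2 + eps / 2 by field.
apply: lerD.
  by apply: dP; apply: le_ball vb; rewrite /r !ge_min lexx !orbT.
apply: le_trans (mv _ _ _ _) _.
- by apply: le_ball sb; rewrite /r !ge_min lexx.
- by apply: le_ball vb; rewrite /r !ge_min lexx.
- rewrite mulrC -ler_pdivlMr// ltW// distrC.
  by apply: lt_le_trans sb _; rewrite /r !ge_min lexx !orbT.
Qed.

Lemma continuous_slice (g : R * R -> R) (t u : R) :
  {for (t, u), continuous g} -> {for u, continuous (fun v => g (t, v))}.
Proof.
move=> cg; apply: (@continuous_comp _ _ _ (fun v : R => (t, v)) g) => //.
exact: (@cvg_pair R _ _ (nbhs u) (nbhs t) (nbhs u) _ _ _ (fun=> t) id (cvg_cst _) (@cvg_id _ _)).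
Qed.

(** Provides the constant dominating function that differentiation under the
    integral requires. *)
Lemma rectangle_bounded (g : R -> R -> R) (a b c d : R) :
  (forall s v, a <= s <= b -> c <= v <= d ->
     {for (s, v), continuous (fun q : R * R => g q.1 q.2)}) ->
  exists M, forall s v, a <= s <= b -> c <= v <= d -> `|g s v| <= M.
Proof.
move=> cg.
have K : compact (`[a, b] `*` `[c, d]).
  by apply: compact_setX; exact: segment_compact.
have cgK : {within (`[a, b] `*` `[c, d]), continuous (fun q : R * R => g q.1 q.2)}.
  apply: continuous_in_subspaceT => -[s v]; rewrite inE => -[/=].
  by rewrite !in_itv/=; exact: cg.
have [M [Mr MP]] := compact_bounded (continuous_compact cgK K).
exists (M + 1) => s v sab vcd.
apply: (MP (M + 1)); first by rewrite ltrDl.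
by exists (s, v) => //; split; rewrite /= in_itv.
Qed.

Lemma is_derive_interval_integral (p dp : R -> R -> R) (a b t : R) : 0 < t ->
  (forall s v : R, 0 < s -> is_derive s 1 (p ^~ v) (dp s v)) ->
  (forall s : R, 0 < s -> continuous (p s)) ->
  (forall s v : R, 0 < s -> {for (s, v), continuous (fun q : R * R => dp q.1 q.2)}) ->
  is_derive t 1 (fun s => (\int[mu]_(u in `[a, b]) p s u)%R)
    (\int[mu]_(u in `[a, b]) dp t u)%R.
Proof.
move=> t0 pd cp cdp.
have [M MP] : exists M, forall s v : R, t / 2 <= s <= 2 * t -> a <= v <= b ->
    `|dp s v| <= M.
  apply: rectangle_bounded => s v /andP[ts _] _; apply: cdp; lra.
have It : `]t / 2, 2 * t[%classic t by rewrite /= in_itv/=; apply/andP; split; lra.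
have pos s : `]t / 2, 2 * t[%classic s -> 0 < s.
  by rewrite /= in_itv/= => /andP[]; lra.
have int_p s : `]t / 2, 2 * t[%classic s -> mu.-integrable `[a, b] (EFin \o p s).
  move=> /pos s0; apply: continuous_compact_integrable; first exact: segment_compact.
  by apply: continuous_subspaceT; exact: cp.
have dpE s v : 0 < s -> derive1 (p ^~ v) s = dp s v.
  by move=> s0; rewrite derive1E; have ? := pd s v s0; exact: derive_val.
have derp s v : `]t / 2, 2 * t[%classic s -> `[a, b]%classic v -> derivable (p ^~ v) s 1.
  by move=> /pos s0 _; have ? := pd s v s0; exact: ex_derive.
have intM : mu.-integrable `[a, b] (EFin \o (fun _ => `|M|)).
  apply: continuous_compact_integrable; first exact: segment_compact.
  by apply: continuous_subspaceT; exact: cst_continuous.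
have ub s v : `]t / 2, 2 * t[%classic s -> `[a, b]%classic v ->
    `|partial1of2 p s v| <= `|M|.
  move=> Is vab; rewrite /partial1of2 dpE; last exact: pos.
  apply: le_trans (ler_norm M); apply: MP; last by move: vab; rewrite /= in_itv.
  by move: Is; rewrite /= in_itv/= => /andP[/ltW -> /ltW ->].
have -> : (\int[mu]_(u in `[a, b]) dp t u = derive1 (fun s => \int[mu]_(u in `[a, b]) p s u) t)%R.
  rewrite (@differentiation_under_integral R _ _ mu p `[a, b]%classic _ t _ _ It int_p derp _ _ intM ub)//.
  by apply: eq_Rintegral => v _; rewrite /partial1of2 dpE.
rewrite derive1E; apply: derivableP.
exact: (@derivable_under_integral R _ _ mu p `[a, b]%classic _ t _ _ It int_p derp _ _ intM ub).
Qed.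

Lemma interval_FTC (f F : R -> R) (a b : R) : a < b ->
  continuous f -> (forall u : R, is_derive u 1 F (f u)) ->
  (\int[mu]_(u in `[a, b]) f u = F b - F a)%R.
Proof.
move=> ab cf dF.
have cF : continuous F.
  by move=> u; apply/differentiable_continuous/derivable1_diffP; exact: ex_derive.
rewrite /Rintegral (@continuous_FTC2 _ f F)//.
- exact: continuous_subspaceT.
- split.
  + by move=> u _; exact: ex_derive.
  + by apply: cvg_at_right_filter; exact: cF.
  + by apply: cvg_at_left_filter; exact: cF.
- by move=> u _; rewrite derive1E; exact: derive_val.
Qed.

(** The first integrand minus the second is the derivative of the flux [- (xi -
    u) f phi + k (f' phi - f phi')], which vanishes at both ends. *)
Lemma Green_formula (f phi f1 f2 phi1 phi2 : R -> R) (xi k a b : R) : a < b ->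
  (forall u : R, is_derive u 1 f (f1 u)) -> (forall u : R, is_derive u 1 f1 (f2 u)) ->
  (forall u : R, is_derive u 1 phi (phi1 u)) -> (forall u : R, is_derive u 1 phi1 (phi2 u)) ->
  continuous f2 -> continuous phi2 ->
  phi a = 0 -> phi b = 0 -> phi1 a = 0 -> phi1 b = 0 ->
  (\int[mu]_(u in `[a, b])
    ((f u - (xi - u) * f1 u + k * f2 u) * phi u) =
   \int[mu]_(u in `[a, b])
    (f u * ((xi - u) * phi1 u + k * phi2 u)))%R.
Proof.
move=> ab df df1 dphi dphi1 cf2 cphi2 pa pb p1a p1b.
have dc (g g' : R -> R) : (forall u : R, is_derive u 1 g (g' u)) -> continuous g.
  by move=> H u; apply/differentiable_continuous/derivable1_diffP; exact: ex_derive.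
have cf := dc _ _ df; have cf1 := dc _ _ df1.
have cphi := dc _ _ dphi; have cphi1 := dc _ _ dphi1.
pose Z u := - ((xi - u) * f u * phi u) + k * (f1 u * phi u - f u * phi1 u).
pose z u := (f u - (xi - u) * f1 u + k * f2 u) * phi u
            - f u * ((xi - u) * phi1 u + k * phi2 u).
have dZ (u : R) : is_derive u 1 Z (z u).
  apply: is_derive_eq; rewrite /z /GRing.scale /=; ring.
have cxi : continuous (fun u : R => xi - u).
  by move=> u; apply: cvgB; [exact: cvg_cst|exact: cvg_id].
have c1 : continuous (fun u => (f u - (xi - u) * f1 u + k * f2 u) * phi u).
  move=> u; apply: cvgM; last exact: cphi.
  apply: cvgD; last by apply: cvgM; [exact: cvg_cst|exact: cf2].
  apply: cvgB; first exact: cf.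
  by apply: cvgM; [exact: cxi|exact: cf1].
have c2 : continuous (fun u => f u * ((xi - u) * phi1 u + k * phi2 u)).
  move=> u; apply: cvgM; first exact: cf.
  apply: cvgD; last by apply: cvgM; [exact: cvg_cst|exact: cphi2].
  by apply: cvgM; [exact: cxi|exact: cphi1].
have ci g : continuous g -> mu.-integrable `[a, b] (EFin \o g).
  move=> cg; apply: continuous_compact_integrable; first exact: segment_compact.
  exact: continuous_subspaceT.
apply/eqP; rewrite -subr_eq0 -RintegralB//; [|exact: ci|exact: ci].
rewrite (interval_FTC ab _ dZ); last by move=> u; apply: cvgB; [exact: c1|exact: c2].
by rewrite /Z pa pb p1a p1b; apply/eqP; ring.
Qed.

End IntervalCalculus.

(** * Tapering to a bounded window *)

Section Taper.
Context {R : realType}.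
Local Notation mu := (@lebesgue_measure R).
Variable xi : R.
Local Notation window r := (`[(xi - r)%R, (xi + r)%R]%classic).

(** Used only for [|u - xi| <= r]. The square makes the function and its first
    derivative vanish at the two ends of the window, which is what integration
    by parts asks for. *)
Definition taper (r u : R) : R := (1 - ((u - xi) / r) ^+ 2) ^+ 2.
Definition taper1 (r u : R) : R := - (4 * (u - xi) / r ^+ 2) * (1 - ((u - xi) / r) ^+ 2).
Definition taper2 (r u : R) : R := (12 * ((u - xi) / r) ^+ 2 - 4) / r ^+ 2.

Lemma is_derive_taper (r u : R) : r != 0 -> is_derive u 1 (taper r) (taper1 r u).
Proof.
by move=> r0; apply: is_derive_eq; rewrite /taper1 /GRing.scale /=; field.
Qed.

Lemma is_derive_taper1 (r u : R) : r != 0 -> is_derive u 1 (taper1 r) (taper2 r u).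
Proof.
by move=> r0; apply: is_derive_eq; rewrite /taper2 /GRing.scale /=; field.
Qed.

Lemma continuous_sub (c : R) : continuous (fun u : R => u - c).
Proof. by move=> u; apply: cvgB; [exact: cvg_id|exact: cvg_cst]. Qed.

Lemma continuous_taper2 (r : R) : continuous (taper2 r).
Proof.
move=> u; apply: cvgM; last exact: cvg_cst.
apply: cvgB; last exact: cvg_cst.
apply: cvgM; first exact: cvg_cst.
have c : {for u, continuous (fun u => (u - xi) / r)}.
  by apply: cvgM; [exact: continuous_sub|exact: cvg_cst].
exact: (continuous_comp c (@exprn_continuous _ 2 _)).
Qed.

Lemma in_window (r u : R) : window r u = (`|u - xi| <= r) :> Prop.
Proof. by rewrite /= in_itv/= lter_distl. Qed.

Lemma taper_edge (r u : R) : r != 0 -> (u = xi - r) \/ (u = xi + r) ->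
  taper r u = 0 /\ taper1 r u = 0.
Proof.
move=> r0 H; have y1 : ((u - xi) / r) ^+ 2 = 1 by case: H => ->; field.
by rewrite /taper /taper1 y1 subrr mulr0 expr2 mulr0.
Qed.

(** Reduces each estimate on the taper to an inequality in the single number [y
    = |u - xi| / r] of the unit interval. *)
Lemma window_ratio (r u : R) : 0 < r -> `|u - xi| <= r ->
  exists2 y, 0 <= y <= 1 & `|u - xi| = y * r /\ ((u - xi) / r) ^+ 2 = y ^+ 2.
Proof.
move=> r0 ur; exists (`|u - xi| / r).
  by rewrite divr_ge0 ?(ltW r0)//= ler_pdivrMr// mul1r.
split; first by rewrite divfK// gt_eqF.
by rewrite [RHS]expr_div_n real_normK ?num_real// expr_div_n.
Qed.

Lemma taper_defect (r u : R) : 0 < r -> `|u - xi| <= r ->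
  `|taper r u - 1| <= 2 / r * `|u - xi|.
Proof.
move=> r0 /(window_ratio r0)[y /andP[y0 y1] [-> yE]].
have -> : 2 / r * (y * r) = 2 * y by field; rewrite gt_eqF.
rewrite /taper yE; set z := y ^+ 2.
have z0 : 0 <= z by exact: sqr_ge0.
have zy : z <= y by rewrite /z expr2; nra.
by rewrite ler_norml; apply/andP; split; nra.
Qed.

Lemma taper1_le (r u : R) : 0 < r -> `|u - xi| <= r -> `|taper1 r u| <= 4 / r.
Proof.
move=> r0 /(window_ratio r0)[y /andP[y0 y1] [vE yE]].
rewrite /taper1 yE normrM normrN !normrM vE normfV normrX (ger0_norm (ltW r0)) normr_nat.
have -> : 4 * (y * r) / r ^+ 2 = 4 / r * y by field; rewrite gt_eqF.
rewrite -(mulrA (4 / r)) ler_piMr ?divr_ge0 ?(ltW r0)//.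
have z1 : 0 <= y ^+ 2 <= 1 by rewrite sqr_ge0/= expr2; nra.
by rewrite ger0_norm; nra.
Qed.

(** The drift of the adjoint operator grows linearly; the factor [1 / r] gained
    by differentiating the taper compensates for it, up to the weight. *)
Lemma sub_taper1_le (r u : R) : 0 < r -> `|u - xi| <= r ->
  `|(u - xi) * taper1 r u| <= 4 / r * `|u - xi|.
Proof.
move=> r0 ur; rewrite normrM mulrC ler_wpM2r//; exact: taper1_le.
Qed.

Lemma taper2_le (r u : R) : 1 <= r -> `|u - xi| <= r -> `|taper2 r u| <= 8 / r.
Proof.
move=> r1; have r0 : 0 < r by lra.
move=> /(window_ratio r0)[y /andP[y0 y1] [vE yE]].
rewrite /taper2 yE normrM normfV normrX (ger0_norm (ltW r0)).
apply: (@le_trans _ _ (8 / r ^+ 2)).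
  rewrite ler_wpM2r ?invr_ge0 ?sqr_ge0//.
  rewrite ler_norml; apply/andP; split; nra.
rewrite ler_wpM2l// lef_pV2 ?posrE ?exprn_gt0//; nra.
Qed.

Lemma dist_weight (u : R) : 1 + `|u - xi| <= (1 + `|xi|) * (1 + `|u|).
Proof.
have := ler_normB u xi.
have := normr_ge0 u; have := normr_ge0 xi; nra.
Qed.

Lemma window_pairing_le (f k : R -> R) (r K : R) : 0 <= K -> wint f -> continuous k ->
  (forall u, `|u - xi| <= r -> `|k u| <= K * (1 + `|u|)) ->
  `|\int[mu]_(u in window r) (f u * k u)| <= K * wnorm f.
Proof.
move=> K0 fi ck kK; rewrite Rintegral_mkcond.
have -> : ((fun u => f u * k u) \_ (window r) = (fun u => f u * (k \_ (window r)) u))%R.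
  by apply/funext => u; rewrite !patchE; case: ifP => //; rewrite mulr0.
apply: wintM_le => //.
  apply/measurable_restrict => //; rewrite setTI.
  exact: measurable_funTS (continuous_measurable_fun _).
move=> u; rewrite patchE; case: ifPn => [|_]; last first.
  by rewrite normr0 mulr_ge0// ltW// weight_gt0.
by rewrite inE in_window; exact: kK.
Qed.

(** The taper differs from 1 by at most [2 |u - xi| / r], inside the window by
    expansion and outside it because the ratio exceeds 1 there; the weight
    absorbs the numerator. *)
Lemma taper_approx (f k : R -> R) (r K : R) : 0 < r -> wint f -> continuous k ->
  (forall u, `|k u| <= K) ->
  `|\int[mu]_(u in window r) (f u * (k u * taper r u)) - \int[mu]_u (f u * k u)| <=
     2 * K * (1 + `|xi|) / r * wnorm f.
Proof.
move=> r0 fi ck kK.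
have K0 : 0 <= K by apply: le_trans (kK 0).
have r_neq0 : r != 0 by rewrite gt_eqF.
have ct : continuous (taper r).
  by move=> u; apply: is_derive_continuous; exact: is_derive_taper.
have ckt : continuous (fun u => k u * taper r u).
  by move=> u; apply: cvgM; [exact: ck|exact: ct].
rewrite Rintegral_mkcond.
pose h := (fun u => k u * taper r u) \_ (window r).
have -> : ((fun u => f u * (k u * taper r u)) \_ (window r) = (fun u => f u * h u))%R.
  by apply/funext => u; rewrite /h !patchE; case: ifP => //; rewrite mulr0.
have mh : measurable_fun setT h.
  apply/measurable_restrict => //; rewrite setTI.
  exact: measurable_funTS (continuous_measurable_fun _).
have mk : measurable_fun setT k by exact: continuous_measurable_fun.
have w1 (u : R) : K <= K * (1 + `|u|) by rewrite ler_peMr// lerDl.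
have hk u : `|h u - k u| <= 2 * K * (1 + `|xi|) / r * (1 + `|u|).
  have step : `|h u - k u| <= K * (2 / r * `|u - xi|).
    rewrite /h patchE; case: ifPn.
      rewrite inE in_window => ur.
      rewrite -{2}[k u]mulr1 -mulrBr normrM ler_pM//; exact: taper_defect.
    move=> /negP; rewrite inE in_window => /negP; rewrite -ltNge => ru.
    rewrite sub0r normrN -[leLHS]mulr1 ler_pM//.
    rewrite mulrAC ler_pdivlMr// mul1r; lra.
  apply: le_trans step _.
  have -> : 2 * K * (1 + `|xi|) / r * (1 + `|u|) = K * (2 / r * ((1 + `|xi|) * (1 + `|u|))).
    by field.
  apply: ler_wpM2l => //; apply: ler_wpM2l; first by rewrite divr_ge0// ltW.
  by apply: le_trans (dist_weight u); rewrite lerDr.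
have kw u : `|k u| <= K * (1 + `|u|) by exact: le_trans (kK u) (w1 u).
have hw u : `|h u| <= (2 * K * (1 + `|xi|) / r + K) * (1 + `|u|).
  have -> : h u = (h u - k u) + k u by rewrite subrK.
  by rewrite mulrDl; apply: le_trans (ler_normD _ _) (lerD (hk u) (kw u)).
rewrite -RintegralB//; [|exact: wintM fi mh hw|exact: wintM fi mk kw].
under eq_Rintegral do rewrite -mulrBr.
by apply: wintM_le => //; exact: measurable_funB.
Qed.

End Taper.

(** * Cosine transforms with a phase *)

Section CosineTransform.
Context {R : realType}.
Local Notation mu := (@lebesgue_measure R).
Variable xi : R.

Definition phase (w th u : R) : R := w * (u - xi) + th.

(** With [th] equal to [w xi], respectively [w xi - pi / 2], this is the
    integral of [f] against [cos (w u)], respectively [sin (w u)]. Centring at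
    [xi] removes the drift velocity from the characteristics. *)
Definition cos_transform (f : R -> R) (w th : R) : R :=
  (\int[mu]_u (f u * cos (phase w th u)))%R.

Lemma is_derive_cos_phase (w th u : R) :
  is_derive u 1 (fun u => cos (phase w th u)) (- (w * sin (phase w th u))).
Proof. by apply: is_derive_eq; rewrite /GRing.scale /=; ring. Qed.

Lemma is_derive_sin_phase (w th u : R) :
  is_derive u 1 (fun u => sin (phase w th u)) (w * cos (phase w th u)).
Proof. by apply: is_derive_eq; rewrite /GRing.scale /=; ring. Qed.

Lemma continuous_cos_phase (w th : R) : continuous (fun u => cos (phase w th u)).
Proof. by move=> u; apply: is_derive_continuous; exact: is_derive_cos_phase. Qed.

Lemma continuous_sin_phase (w th : R) : continuous (fun u => sin (phase w th u)).
Proof. by move=> u; apply: is_derive_continuous; exact: is_derive_sin_phase. Qed.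

Lemma cos_norm_le1 (x : R) : `|cos x| <= 1.
Proof. by rewrite ler_norml cos_geN1 cos_le1. Qed.

Lemma sin_norm_le1 (x : R) : `|sin x| <= 1.
Proof. by rewrite ler_norml sin_geN1 sin_le1. Qed.

Lemma cos_lipschitz (x y : R) : `|cos x - cos y| <= `|x - y|.
Proof.
have H (a b : R) : a <= b -> `|cos b - cos a| <= b - a.
  move=> ab; rewrite -[leRHS]mul1r.
  apply: (@MVT_le _ _ (fun x => - sin x)) => //.
    exact/continuous_subspaceT/continuous_cos.
  by move=> z _; rewrite normrN sin_norm_le1.
have [xy|yx] := lerP x y.
  by rewrite distrC; exact: H.
by apply: H; exact: ltW.
Qed.

Lemma sin_cos_shift (x : R) : sin x = cos (x - pi / 2).
Proof. by rewrite cosB cos_pihalf sin_pihalf mulr0 add0r mulr1. Qed.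

Lemma weight_ge1 (u : R) : 1 <= 1 + `|u|.
Proof. by rewrite lerDl. Qed.

Lemma bounded_weight (h : R -> R) (K : R) : (forall u, `|h u| <= K) ->
  forall u, `|h u| <= K * (1 + `|u|).
Proof.
move=> hK u; apply: le_trans (hK u) _; rewrite ler_peMr ?weight_ge1//.
by apply: le_trans (hK 0).
Qed.

Lemma cos_phase_weight (w th u : R) : `|cos (phase w th u)| <= 1 * (1 + `|u|).
Proof.
apply: (@bounded_weight (fun u => cos (phase w th u))) => v; exact: cos_norm_le1.
Qed.

Lemma measurable_cos_phase (w th : R) : measurable_fun setT (fun u => cos (phase w th u)).
Proof. by apply: continuous_measurable_fun; exact: continuous_cos_phase. Qed.

Lemma cos_transform_le (f : R -> R) (w th : R) : wint f ->
  `|cos_transform f w th| <= wnorm f.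
Proof.
move=> fi; rewrite -[leRHS]mul1r; apply: wintM_le => //.
  exact: measurable_cos_phase.
exact: cos_phase_weight.
Qed.

Lemma cos_phase_integrable (f : R -> R) (w th : R) : wint f ->
  mu.-integrable setT (EFin \o (fun u => f u * cos (phase w th u))).
Proof.
move=> fi; apply: (@wintM _ _ _ 1 fi); first exact: measurable_cos_phase.
exact: cos_phase_weight.
Qed.

Lemma dist_le_weight (u : R) : `|u - xi| <= (1 + `|xi|) * (1 + `|u|).
Proof. by apply: le_trans (dist_weight xi u); rewrite lerDr. Qed.

(** The weight is exactly what dominates the derivative of the integrand in the
    frequency. *)
Lemma is_derive_cos_transform (f : R -> R) (w th : R) : wint f ->
  is_derive w 1 (fun w => cos_transform f w th)
    (- (\int[mu]_u (f u * ((u - xi) * sin (phase w th u)))))%R.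
Proof.
move=> fi; have mf := wint_measurable fi.
pose p (w u : R) := f u * cos (phase w th u).
have dp (s v : R) : is_derive s 1 (p ^~ v) (- (f v * ((v - xi) * sin (phase s th v)))).
  by apply: is_derive_eq; rewrite /GRing.scale /=; ring.
have Iw : `]w - 1, w + 1[%classic w by rewrite /= in_itv/=; apply/andP; split; lra.
have int_p s : `]w - 1, w + 1[%classic s -> mu.-integrable setT (EFin \o p s).
  by move=> _; exact: cos_phase_integrable.
have dpE s v : derive1 (p ^~ v) s = - (f v * ((v - xi) * sin (phase s th v))).
  by rewrite derive1E; have ? := dp s v; exact: derive_val.
have derp s v : `]w - 1, w + 1[%classic s -> setT v -> derivable (p ^~ v) s 1.
  by move=> _ _; have ? := dp s v; exact: ex_derive.
pose G u := (1 + `|xi|) * ((1 + `|u|) * `|f u|).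
have G0 u : 0 <= G u by rewrite !mulr_ge0// ltW// weight_gt0.
have intG : mu.-integrable setT (EFin \o G).
  exact: (integrableZl measurableT (1 + `|xi|) (wint_norm fi)).
have ub s v : `]w - 1, w + 1[%classic s -> setT v -> `|partial1of2 p s v| <= G v.
  move=> _ _; rewrite /partial1of2 dpE normrN !normrM /G.
  rewrite [leRHS]mulrA [leLHS]mulrC; apply: ler_wpM2r => //.
  rewrite -[leRHS]mulr1; apply: ler_pM => //; last exact: sin_norm_le1.
  exact: dist_le_weight.
have -> : (- (\int[mu]_u (f u * ((u - xi) * sin (phase w th u)))) =
   derive1 (fun w => cos_transform f w th) w)%R.
  rewrite (@differentiation_under_integral R _ _ mu p setT _ w _ _ Iw int_p derp _ G0 intG ub)//.
  rewrite -mulN1r -RintegralZl//.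
    by apply: eq_Rintegral => v _; rewrite /partial1of2 dpE mulN1r.
  apply: (@wintM _ _ _ (1 + `|xi|)) => //.
    apply: continuous_measurable_fun => u; apply: cvgM; first exact: continuous_sub.
    exact: continuous_sin_phase.
  move=> u; rewrite normrM -[leRHS]mulr1 ler_pM//; first exact: dist_le_weight.
  exact: sin_norm_le1.
rewrite derive1E; apply: derivableP.
exact: (@derivable_under_integral R _ _ mu p setT _ w _ _ Iw int_p derp _ G0 intG ub).
Qed.

Local Notation window r := (`[(xi - r)%R, (xi + r)%R]%classic).

Lemma ge0_small (c : R) (K : R) : (forall r : R, 1 <= r -> c <= K / r) -> c <= 0.
Proof.
move=> H; rewrite leNgt; apply/negP => c0.
have K0 : 0 < K by have := H 1 (lexx _); rewrite divr1; exact: lt_le_trans.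
(* At this r the bound K / r is at most c / 2. *)
pose r := Num.max 1 (2 * K / c).
have r1 : 1 <= r by rewrite /r le_max lexx.
have r2 : 2 * K / c <= r by rewrite /r le_max lexx orbT.
have r0 : 0 < r by lra.
have := H r r1; rewrite ler_pdivlMr//.
by move: r2; rewrite ler_pdivrMr//; nra.
Qed.

(** The boundary terms at infinity are removed by the taper, which costs an
    error [O(1 / r)] by the weighted integrability of [f] and [f']. *)
Lemma integral_by_parts (f f1 k k1 : R -> R) (K : R) : wint f -> wint f1 ->
  (forall u : R, is_derive u 1 f (f1 u)) -> (forall u : R, is_derive u 1 k (k1 u)) ->
  continuous f1 -> continuous k1 ->
  (forall u, `|k u| <= K) -> (forall u, `|k1 u| <= K) ->
  (\int[mu]_u (f1 u * k u) = - \int[mu]_u (f u * k1 u))%R.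
Proof.
move=> fi f1i df dk cf1 ck1 kK k1K.
have K0 : 0 <= K by apply: le_trans (kK 0).
have ck : continuous k by move=> u; apply: is_derive_continuous.
have cf : continuous f by move=> u; apply: is_derive_continuous.
apply/eqP; rewrite -subr_eq0 opprK -normr_eq0 eq_le normr_ge0 andbT.
apply: (@ge0_small _ (2 * K * (1 + `|xi|) * wnorm f1 + 2 * K * (1 + `|xi|) * wnorm f
   + 4 * K * wnorm f)) => r r1.
have r0 : 0 < r by lra.
have rn0 : r != 0 by rewrite gt_eqF.
have ct : continuous (taper xi r).
  by move=> u; apply: is_derive_continuous; exact: is_derive_taper.
have ct1 : continuous (taper1 xi r).
  by move=> u; apply: is_derive_continuous; exact: is_derive_taper1.
have e1 := taper_approx xi r0 f1i ck kK.
have e2 := taper_approx xi r0 fi ck1 k1K.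
have e3 : `|\int[mu]_(u in window r) (f u * (k u * taper1 xi r u))| <= 4 * K / r * wnorm f.
  apply: (@window_pairing_le _ xi f _ r) => //.
  - by rewrite !mulr_ge0// invr_ge0 ltW.
  - by move=> u; apply: cvgM; [exact: ck|exact: ct1].
  - move=> u ur; rewrite normrM.
    apply: (@le_trans _ _ (K * (4 / r))); first by rewrite ler_pM// taper1_le.
    have -> : 4 * K / r * (1 + `|u|) = K * (4 / r) * (1 + `|u|) by field.
    by rewrite ler_peMr ?weight_ge1// mulr_ge0// divr_ge0// ltW.
have e4 : (\int[mu]_(u in window r) (f1 u * (k u * taper xi r u)) +
   \int[mu]_(u in window r) (f u * (k1 u * taper xi r u)) +
   \int[mu]_(u in window r) (f u * (k u * taper1 xi r u)) = 0)%R.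
  have ci (g : R -> R) : continuous g -> mu.-integrable (window r) (EFin \o g).
    move=> cg; apply: continuous_compact_integrable; first exact: segment_compact.
    exact: continuous_subspaceT.
  have c1 : continuous (fun u => f1 u * (k u * taper xi r u)).
    by move=> u; apply: cvgM; [exact: cf1|apply: cvgM; [exact: ck|exact: ct]].
  have c2 : continuous (fun u => f u * (k1 u * taper xi r u)).
    by move=> u; apply: cvgM; [exact: cf|apply: cvgM; [exact: ck1|exact: ct]].
  have c3 : continuous (fun u => f u * (k u * taper1 xi r u)).
    by move=> u; apply: cvgM; [exact: cf|apply: cvgM; [exact: ck|exact: ct1]].
  have c12 : continuous (fun u => f1 u * (k u * taper xi r u) + f u * (k1 u * taper xi r u)).
    by move=> u; apply: cvgD; [exact: c1|exact: c2].
  rewrite -RintegralD//; [|exact: ci|exact: ci].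
  rewrite -RintegralD//; [|exact: ci|exact: ci].
  have dT (u : R) : is_derive u 1 (fun u => f u * (k u * taper xi r u))
      (f1 u * (k u * taper xi r u) + f u * (k1 u * taper xi r u)
        + f u * (k u * taper1 xi r u)).
    have ? := is_derive_taper xi u rn0.
    by apply: is_derive_eq; rewrite /GRing.scale /=; ring.
  have ab : xi - r < xi + r by lra.
  rewrite (interval_FTC ab _ dT).
    have [-> _] := taper_edge (xi := xi) rn0 (or_introl erefl).
    have [-> _] := taper_edge (xi := xi) rn0 (or_intror erefl).
    by rewrite !mulr0 subrr.
  by move=> u; apply: cvgD; [exact: c12|exact: c3].
(* The three tapered integrals add up to zero, and the first two approximate A
   and B. *)
have triangle (A B i1 i2 i3 a b c : R) : `|i1 - A| <= a -> `|i2 - B| <= b ->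
    `|i3| <= c -> i1 + i2 + i3 = 0 -> `|A + B| <= a + b + c.
  move=> h1 h2 h3 h; have -> : A + B = - (i1 - A) - (i2 - B) - i3 by lra.
  apply: le_trans (ler_normB _ _) _; apply: lerD => //.
  by apply: le_trans (ler_normB _ _) _; rewrite normrN; exact: lerD.
by have := triangle _ _ _ _ _ _ _ _ e1 e2 e3 e4; congr (_ <= _); field.
Qed.

End CosineTransform.

(** * The transform of the Maxwellian and of its derivative *)

Section Gaussian.
Context {R : realType}.
Local Notation mu := (@lebesgue_measure R).
Variables (sigma xi : R).
Hypothesis sigma_gt0 : 0 < sigma.
Local Notation F := (Maxwellian sigma xi).

Lemma gauss_integrable (k c : R) : 0 < k ->
  mu.-integrable setT (EFin \o (fun u => expR (- (k * (u - c) ^+ 2)))).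
Proof.
move=> k0; pose s := Num.sqrt (2 * k)^-1.
have s2 : s ^+ 2 = (2 * k)^-1 by rewrite sqr_sqrtr// invr_ge0; lra.
have s0 : s != 0 by rewrite gt_eqF// sqrtr_gt0 invr_gt0; lra.
have := integrableZl measurableT (normal_peak s)^-1 (integrable_normal_pdf c s).
apply: eq_integrable => // u _ /=.
rewrite -EFinM normal_pdfE// /normal_fun mulKf ?gt_eqF ?normal_peak_gt0//.
congr (expR _)%:E; rewrite s2 mulr2n; field.
lra.
Qed.

Definition dMaxwellian (u : R) : R := - (2 * (u - xi) / sigma ^+ 2) * F u.

Let sigma_neq0 : sigma != 0. Proof. by rewrite gt_eqF. Qed.

Lemma is_derive_Maxwellian (u : R) : is_derive u 1 F (dMaxwellian u).
Proof.
rewrite /Maxwellian /dMaxwellian /Maxwellian.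
apply: is_derive_eq; rewrite /GRing.scale /=; field.
by rewrite sigma_neq0 gt_eqF// sqrtr_gt0 mulr_gt0 ?pi_gt0// exprn_gt0.
Qed.

Lemma continuous_Maxwellian : continuous F.
Proof. by move=> u; apply: is_derive_continuous; exact: is_derive_Maxwellian. Qed.

Lemma continuous_dMaxwellian : continuous dMaxwellian.
Proof.
move=> u; apply: cvgM; last exact: continuous_Maxwellian.
apply: cvgN; apply: cvgM; last exact: cvg_cst.
by apply: cvgM; [exact: cvg_cst|exact: continuous_sub].
Qed.

Lemma derive1_Maxwellian : derive1 F = dMaxwellian.
Proof.
apply/funext => u; rewrite derive1E.
by have ? := is_derive_Maxwellian u; exact: derive_val.
Qed.

Let peak := (Num.sqrt (pi * sigma ^+ 2))^-1 : R.

Lemma Maxwellian_ge0 (u : R) : 0 <= F u.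
Proof. by rewrite mulr_ge0 ?expR_ge0// invr_ge0 sqrtr_ge0. Qed.

(** Half of the Gaussian exponent absorbs the polynomial factor, because [1 + z
    <= e^z]. *)
Lemma gauss_domination : exists C : R, forall u,
  (1 + `|u|) * (1 + `|u - xi|) * F u <= C * expR (- (sigma ^- 2 / 2 * (u - xi) ^+ 2)).
Proof.
have p0 : 0 <= peak by rewrite invr_ge0 sqrtr_ge0.
exists ((1 + `|xi|) * (2 * (1 + 2 * sigma ^+ 2)) * peak) => u.
have s2 : 0 < sigma ^+ 2 by rewrite exprn_gt0.
pose y := `|u - xi|; have y0 : 0 <= y by exact: normr_ge0.
have yE : (u - xi) ^+ 2 = y ^+ 2 by rewrite /y real_normK ?num_real.
pose z := sigma ^- 2 / 2 * y ^+ 2.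
have z0 : 0 <= z by rewrite !mulr_ge0 ?invr_ge0 ?sqr_ge0.
have FE : F u = peak * (expR (- z) * expR (- z)).
  by rewrite /Maxwellian -expRD; congr (_ * expR _); rewrite mulNr yE /z; field.
have y2 : y ^+ 2 = 2 * sigma ^+ 2 * z by rewrite /z; field.
have wu : 1 + `|u| <= (1 + `|xi|) * (1 + y).
  have := ler_normD (u - xi) xi; rewrite subrK -/y.
  have := normr_ge0 xi; nra.
(* z is half of the exponent: the Gaussian is the square of e^(- z), and one of
   the two factors is spent here. *)
have ey : (1 + y) * (1 + y) * expR (- z) <= 2 * (1 + 2 * sigma ^+ 2).
  rewrite expRN ler_pdivrMr ?expR_gt0//.
  have : 1 + z <= expR z by exact: expR_ge1Dx.
  set e := expR z => ez.
  have h1 : (1 + y) * (1 + y) <= 2 * (1 + y ^+ 2).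
    rewrite -subr_ge0; have -> : 2 * (1 + y ^+ 2) - (1 + y) * (1 + y) = (1 - y) ^+ 2 by ring.
    exact: sqr_ge0.
  apply: le_trans h1 _; rewrite -mulrA ler_wpM2l// y2; nra.
rewrite FE yE -/z -/y.
have -> : (1 + `|u|) * (1 + y) * (peak * (expR (- z) * expR (- z))) =
    (1 + `|u|) * ((1 + y) * expR (- z)) * (peak * expR (- z)) by ring.
have -> : (1 + `|xi|) * (2 * (1 + 2 * sigma ^+ 2)) * peak * expR (- z) =
    (1 + `|xi|) * (2 * (1 + 2 * sigma ^+ 2)) * (peak * expR (- z)) by ring.
have ez0 := expR_ge0 (- z).
apply: ler_wpM2r; first by rewrite mulr_ge0.
apply: (@le_trans _ _ ((1 + `|xi|) * (1 + y) * ((1 + y) * expR (- z)))).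
  by apply: ler_wpM2r wu; rewrite mulr_ge0//; lra.
by rewrite -mulrA ler_wpM2l ?addr_ge0// mulrA.
Qed.

Lemma wint_gauss (f : R -> R) (K : R) : continuous f ->
  (forall u, `|f u| <= K * ((1 + `|u - xi|) * F u)) -> wint f.
Proof.
move=> cf fK; have [C CP] := gauss_domination.
have K0 : 0 <= K.
  have Fp : 0 < (1 + `|xi - xi|) * F xi.
    rewrite mulr_gt0 ?weight_gt0// mulr_gt0 ?expR_gt0// invr_gt0 sqrtr_gt0.
    by rewrite mulr_gt0 ?pi_gt0// exprn_gt0.
  by have := le_trans (normr_ge0 _) (fK xi); rewrite pmulr_lge0.
have k0 : 0 < sigma ^- 2 / 2 by rewrite divr_gt0// invr_gt0 exprn_gt0.
apply: (@le_integrable _ _ _ mu _ measurableT _ _ _ _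
  (integrableZl measurableT (K * C) (gauss_integrable xi k0))).
  apply/measurable_EFinP; apply: measurable_funM; first exact: measurable_weight.
  exact: continuous_measurable_fun.
move=> u _ /=; rewrite lee_fin normrM (ger0_norm (ltW (weight_gt0 u))).
apply: le_trans (ler_norm _).
rewrite -mulrA; apply: le_trans (ler_wpM2l K0 (CP u)).
rewrite -mulrA mulrCA; apply: ler_wpM2l; first exact/ltW/weight_gt0.
exact: fK.
Qed.

Lemma wint_Maxwellian : wint F.
Proof.
apply: (@wint_gauss _ 1 continuous_Maxwellian) => u.
by rewrite mul1r ger0_norm ?Maxwellian_ge0// ler_peMl ?Maxwellian_ge0// weight_ge1.
Qed.

Lemma wint_dMaxwellian : wint dMaxwellian.
Proof.
apply: (@wint_gauss _ (2 / sigma ^+ 2) continuous_dMaxwellian) => u.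
rewrite normrM (ger0_norm (Maxwellian_ge0 u)).
rewrite normrN !normrM normfV normrX (gtr0_norm sigma_gt0) normr_nat [leRHS]mulrA ler_wpM2r ?Maxwellian_ge0//.
rewrite mulrAC ler_wpM2l//; first by rewrite divr_ge0// exprn_ge0// ltW.
by rewrite lerDr.
Qed.

Lemma integral_Maxwellian : (\int[mu]_u F u = 1)%R.
Proof.
pose s := sigma / Num.sqrt 2.
have s2 : s ^+ 2 *+ 2 = sigma ^+ 2.
  by rewrite /s expr_div_n sqr_sqrtr// -mulrnAl -mulr_natr mulfK.
have s0 : s != 0 by rewrite gt_eqF// divr_gt0// sqrtr_gt0.
have -> : F = normal_pdf xi s.
  apply/funext => u; rewrite normal_pdfE// /normal_peak /normal_fun s2 /Maxwellian.
  by congr ((Num.sqrt _)^-1 * _); rewrite -s2 mulrC mulrnAl.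
by rewrite /Rintegral integral_normal_pdf.
Qed.

Lemma cos_transform_dMaxwellianE (w th : R) :
  cos_transform xi dMaxwellian w th = w * (\int[mu]_u (F u * sin (phase xi w th u)))%R.
Proof.
have cs : continuous (fun u => - (w * sin (phase xi w th u))).
  move=> u; apply: cvgN; apply: cvgM; first exact: cvg_cst.
  exact: continuous_sin_phase.
have bc u : `|cos (phase xi w th u)| <= 1 + `|w|.
  by apply: le_trans (cos_norm_le1 _) _; rewrite lerDl.
have bs u : `|- (w * sin (phase xi w th u))| <= 1 + `|w|.
  rewrite normrN normrM; apply: (@le_trans _ _ `|w|); last by rewrite lerDr.
  by rewrite ler_piMr// sin_norm_le1.
rewrite /cos_transform (integral_by_parts xi wint_Maxwellian wint_dMaxwellian
  is_derive_Maxwellian (is_derive_cos_phase xi w th) continuous_dMaxwellian cs bc bs).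
rewrite -mulN1r -!RintegralZl//.
- by apply: eq_Rintegral => u _; ring.
- apply: (@wintM _ _ _ (1 + `|w|) wint_Maxwellian).
    exact: continuous_measurable_fun.
  exact: bounded_weight bs.
- apply: (@wintM _ _ _ 1 wint_Maxwellian).
    by apply: continuous_measurable_fun; exact: continuous_sin_phase.
  apply: (@bounded_weight _ (fun u => sin (phase xi w th u))) => u; exact: sin_norm_le1.
Qed.

Lemma sin_cos_phase (w th u : R) : sin (phase xi w th u) = cos (phase xi w (th - pi / 2) u).
Proof. by rewrite sin_cos_shift /phase addrA. Qed.

Lemma cos_sin_phase (w th u : R) : sin (phase xi w (th - pi / 2) u) = - cos (phase xi w th u).
Proof.
by rewrite /phase addrA sinB cos_pihalf sin_pihalf mulr0 mulr1 sub0r.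
Qed.

(** Since [F' = - (2 (u - xi) / sigma^2) F], the transform [h] of [F] satisfies
    [h' = - (sigma^2 / 2) w h], and [h 0 = cos th] because [F] has mass 1. *)
Lemma cos_transform_Maxwellian (w th : R) :
  cos_transform xi F w th = expR (- (sigma ^+ 2 * w ^+ 2 / 4)) * cos th.
Proof.
pose h (w : R) := cos_transform xi F w th.
have dh (s : R) : is_derive s 1 h (- (sigma ^+ 2 / 2 * s * h s)).
  have := is_derive_cos_transform xi s th wint_Maxwellian.
  move=> /is_derive_eq; apply.
  have e : cos_transform xi dMaxwellian s (th - pi / 2) = - (s * h s).
    rewrite cos_transform_dMaxwellianE -[RHS]mulrN /h /cos_transform; congr (_ * _).
    rewrite -mulN1r -RintegralZl//; last exact/cos_phase_integrable/wint_Maxwellian.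
    by apply: eq_Rintegral => u _; rewrite cos_sin_phase; ring.
  have -> : - (sigma ^+ 2 / 2 * s * h s) = sigma ^+ 2 / 2 * - (s * h s) by ring.
  rewrite -e /cos_transform -RintegralZl//; last first.
    exact/cos_phase_integrable/wint_dMaxwellian.
  rewrite -mulN1r -RintegralZl//.
    by apply: eq_Rintegral => u _; rewrite -sin_cos_phase /dMaxwellian; field.
  apply: (@wintM _ _ _ (1 + `|xi|) wint_Maxwellian).
    apply: continuous_measurable_fun => u; apply: cvgM; first exact: continuous_sub.
    exact: continuous_sin_phase.
  move=> u; rewrite normrM -[leRHS]mulr1 ler_pM//; first exact: dist_le_weight.
  exact: sin_norm_le1.
(* Multiplying by the inverse of the expected answer turns the equation for h
   into a vanishing derivative. *)
pose k (w : R) := expR (sigma ^+ 2 * w ^+ 2 / 4) * h w.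
have dk (s : R) : is_derive s 1 k 0.
  by have ? := dh s; apply: is_derive_eq; rewrite /GRing.scale /=; field.
have k0 : k w = k 0 by apply: is_derive_0_is_cst => x; exact: dk.
have h0 : h 0 = cos th.
  rewrite /h /cos_transform /phase.
  under eq_Rintegral do rewrite mul0r add0r.
  rewrite RintegralZr// ?integral_Maxwellian ?mul1r//.
  have := cos_phase_integrable xi 0 0 wint_Maxwellian.
  apply: eq_integrable => // u _ /=.
  by rewrite /phase mul0r add0r cos0 mulr1.
move: k0; rewrite /k h0 expr0n mulr0 mul0r expR0 mul1r => k0.
by rewrite -k0 mulrA -expRD addNr expR0 mul1r.
Qed.

Lemma cos_transform_dMaxwellian (w th : R) :
  cos_transform xi dMaxwellian w th = w * expR (- (sigma ^+ 2 * w ^+ 2 / 4)) * sin th.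
Proof.
rewrite cos_transform_dMaxwellianE -mulrA; congr (_ * _).
rewrite sin_cos_shift -cos_transform_Maxwellian; apply: eq_Rintegral => u _.
by rewrite sin_cos_phase.
Qed.

End Gaussian.

(** * Mass and first moment *)

Section Moments.
Context {R : realType}.
Local Notation mu := (@lebesgue_measure R).
Variable xi : R.

Lemma wint_integrable (f : R -> R) : wint f -> mu.-integrable setT (EFin \o f).
Proof.
move=> fi; have := cos_phase_integrable xi 0 0 fi.
by apply: eq_integrable => // u _ /=; rewrite /phase mul0r add0r cos0 mulr1.
Qed.

Lemma wint_moment_integrable (f : R -> R) : wint f ->
  mu.-integrable setT (EFin \o (fun u => f u * u)).
Proof.
move=> fi; apply: (@wintM _ _ _ 1 fi) => // u.
by rewrite mul1r lerDr.
Qed.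

Lemma first_moment_le (f : R -> R) : wint f -> `|first_moment f| <= wnorm f.
Proof.
move=> fi; rewrite /first_moment; under eq_Rintegral do rewrite mulrC.
rewrite -[leRHS]mul1r; apply: wintM_le => // u.
by rewrite mul1r lerDr.
Qed.

Lemma cos_transform00 (f : R -> R) : cos_transform xi f 0 0 = (\int[mu]_u f u)%R.
Proof. by apply: eq_Rintegral => u _; rewrite /phase mul0r add0r cos0 mulr1. Qed.

(** With phase [- pi / 2] the transform is the integral against [sin (w (u -
    xi))]; its slope at the origin is the centred first moment. *)
Lemma is_derive_cos_transform0 (f : R -> R) : wint f ->
  is_derive (0 : R) 1 (fun w => cos_transform xi f w (- (pi / 2)))
    (first_moment f - xi * (\int[mu]_u f u)%R).
Proof.
move=> fi; apply: is_derive_eq (is_derive_cos_transform xi 0 (- (pi / 2)) fi) _.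
rewrite /first_moment -RintegralZl//; last exact: wint_integrable.
have mi : mu.-integrable setT (EFin \o (fun u => u * f u)).
  by apply: eq_integrable (wint_moment_integrable fi) => // u _ /=; rewrite mulrC.
rewrite -RintegralB//; last exact: (integrableZl measurableT xi (wint_integrable fi)).
rewrite -mulN1r -RintegralZl//.
  apply: eq_Rintegral => u _; rewrite /phase mul0r add0r sinN sin_pihalf; ring.
apply: eq_integrable (integrableB measurableT (integrableZl measurableT xi (wint_integrable fi)) mi) => // u _ /=.
rewrite /phase mul0r add0r sinN sin_pihalf -EFinM -EFinB; congr (_%:E); ring.
Qed.

End Moments.

Section GaussianMoments.
Context {R : realType}.
Local Notation mu := (@lebesgue_measure R).
Variables (sigma xi : R).
Hypothesis sigma_gt0 : 0 < sigma.

Lemma is_derive_uniq (f : R -> R) (x a b : R) :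
  is_derive x 1 f a -> is_derive x 1 f b -> a = b.
Proof.
move=> fa fb; have <- := @derive_val _ _ _ _ _ _ _ fa.
by have <- := @derive_val _ _ _ _ _ _ _ fb.
Qed.

Lemma first_moment_Maxwellian : first_moment (Maxwellian sigma xi) = xi.
Proof.
have := is_derive_cos_transform0 xi (wint_Maxwellian xi sigma_gt0).
have -> : (fun w => cos_transform xi (Maxwellian sigma xi) w (- (pi / 2))) = cst 0.
  apply/funext => w; rewrite cos_transform_Maxwellian//.
  by rewrite cosN cos_pihalf mulr0.
move=> /is_derive_uniq /(_ (is_derive_cst _ _ _)).
by rewrite integral_Maxwellian// mulr1 => /eqP; rewrite subr_eq0 => /eqP.
Qed.

Lemma integral_dMaxwellian : (\int[mu]_u dMaxwellian sigma xi u = 0)%R.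
Proof.
rewrite -(cos_transform00 xi) cos_transform_dMaxwellian//.
by rewrite !mul0r.
Qed.

Lemma first_moment_dMaxwellian : first_moment (dMaxwellian sigma xi) = - 1.
Proof.
have := is_derive_cos_transform0 xi (wint_dMaxwellian xi sigma_gt0).
rewrite integral_dMaxwellian mulr0 subr0.
have -> : (fun w => cos_transform xi (dMaxwellian sigma xi) w (- (pi / 2))) =
   (fun w => - (w * expR (- (sigma ^+ 2 * w ^+ 2 / 4)))).
  apply/funext => w; rewrite cos_transform_dMaxwellian//.
  by rewrite sinN sin_pihalf mulrN1.
have D : is_derive (0 : R) 1 (fun w => - (w * expR (- (sigma ^+ 2 * w ^+ 2 / 4)))) (- 1).
  apply: is_derive_eq; rewrite /GRing.scale /=.
  by rewrite expr0n mulr0 mul0r oppr0 expR0; ring.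
by move=> /is_derive_uniq; apply.
Qed.

End GaussianMoments.

Section Primitive.
Context {R : realType}.
Local Notation mu := (@lebesgue_measure R).

(** Starting the integral at -1 makes 0 an interior point, so that the
    primitive is differentiable there on both sides. *)
Lemma primitive_exists (g : R -> R) : continuous g ->
  exists2 P : R -> R, P 0 = 0 & forall t : R, 0 <= t -> is_derive t 1 P (g t).
Proof.
move=> cg; pose Q (t : R) := (\int[mu]_(u in `[(-1)%R, t]) g u)%R.
exists (fun t => Q t - Q 0) => [|t t0]; first by rewrite subrr.
have tu : t < t + 1 by rewrite ltrDl.
have gi : mu.-integrable `[(-1)%R, (t + 1)%R] (EFin \o g).
  apply: continuous_compact_integrable; first exact: segment_compact.
  exact: continuous_subspaceT.
have t1 : -1 < t by lra.
have [dQ Q't] := continuous_FTC1_closed tu gi t1 (cg t).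
have ? : is_derive t 1 Q (g t) by rewrite -Q't derive1E; exact: derivableP.
by apply: is_derive_eq; rewrite subr0.
Qed.

End Primitive.

(** * Waves solving the adjoint equation *)

Section DualWave.
Context {R : realType}.
Variables (sigma xi w th : R).

Definition amplitude (s : R) : R := expR (sigma ^+ 2 / 4 * (w * expR s) ^+ 2).
(** With [w(s) = w e^s] the amplitude compensates the damping [sigma^2 w(s)^2 /
    2] and the growth of [w(s)] compensates the drift, so the wave solves the
    backward equation [f_s + (xi - u) f_u + (sigma^2 / 2) f_uu = 0]. *)
Definition wave (s u : R) : R := amplitude s * cos (phase xi (w * expR s) th u).
Definition wave_t (s u : R) : R :=
  amplitude s * (sigma ^+ 2 / 2 * (w * expR s) ^+ 2 * cos (phase xi (w * expR s) th u)
    - w * expR s * (u - xi) * sin (phase xi (w * expR s) th u)).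
Definition wave_u (s u : R) : R :=
  - (amplitude s * (w * expR s) * sin (phase xi (w * expR s) th u)).

Lemma is_derive_wave_t (s u : R) : is_derive s 1 (wave ^~ u) (wave_t s u).
Proof. by apply: is_derive_eq; rewrite /wave_t /amplitude /phase /GRing.scale /=; field. Qed.

Lemma is_derive_wave_u (s u : R) : is_derive u 1 (wave s) (wave_u s u).
Proof. by apply: is_derive_eq; rewrite /wave_u /phase /GRing.scale /=; ring. Qed.

Lemma is_derive_wave_uu (s u : R) :
  is_derive u 1 (wave_u s) (- ((w * expR s) ^+ 2 * wave s u)).
Proof. by apply: is_derive_eq; rewrite /wave /phase /GRing.scale /=; ring. Qed.

Section Tapered.
Variable r : R.
Hypothesis r_gt0 : 0 < r.
Let r_neq0 : r != 0. Proof. by rewrite gt_eqF. Qed.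

Definition twave (s u : R) : R := wave s u * taper xi r u.
Definition twave_t (s u : R) : R := wave_t s u * taper xi r u.
Definition twave_u (s u : R) : R := wave_u s u * taper xi r u + wave s u * taper1 xi r u.
Definition twave_uu (s u : R) : R := - ((w * expR s) ^+ 2 * wave s u) * taper xi r u
  + 2 * wave_u s u * taper1 xi r u + wave s u * taper2 xi r u.
(** What is left when the adjoint operator is applied to the tapered wave: only
    terms in which at least one derivative falls on the taper. *)
Definition taper_error (s u : R) : R :=
  wave s u * (- ((u - xi) * taper1 xi r u) + sigma ^+ 2 / 2 * taper2 xi r u)
  + sigma ^+ 2 * wave_u s u * taper1 xi r u.

Lemma is_derive_twave_t (s u : R) : is_derive s 1 (twave ^~ u) (twave_t s u).
Proof.
have ? := is_derive_wave_t s u.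
by apply: is_derive_eq; rewrite /twave_t /GRing.scale /=; ring.
Qed.

Lemma is_derive_twave_u (s u : R) : is_derive u 1 (twave s) (twave_u s u).
Proof.
have ? := is_derive_wave_u s u; have ? := is_derive_taper xi u r_neq0.
by apply: is_derive_eq; rewrite /twave_u /GRing.scale /=; ring.
Qed.

Lemma is_derive_twave_uu (s u : R) : is_derive u 1 (twave_u s) (twave_uu s u).
Proof.
have ? := is_derive_wave_u s u; have ? := is_derive_taper xi u r_neq0.
have ? := is_derive_wave_uu s u; have ? := is_derive_taper1 xi u r_neq0.
by apply: is_derive_eq; rewrite /twave_uu /GRing.scale /=; ring.
Qed.

(** The terms without a derivative of the taper cancel because the wave solves
    the adjoint equation. *)
Lemma dual_equation (s u : R) :
  (xi - u) * twave_u s u + sigma ^+ 2 / 2 * twave_uu s u + twave_t s u = taper_error s u.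
Proof.
by rewrite /twave_u /twave_uu /twave_t /taper_error /wave_u /wave_t /wave; field.
Qed.

End Tapered.

Lemma joint_comp (g : R -> R) (k : R * R -> R) (p : R * R) :
  continuous g -> {for p, continuous k} -> {for p, continuous (fun q => g (k q))}.
Proof. by move=> cg ck; apply: continuous_comp => //; exact: cg. Qed.

Lemma continuous_expR_fst (p : R * R) : {for p, continuous (fun q : R * R => w * expR q.1)}.
Proof.
apply: cvgM; first exact: cvg_cst.
by apply: (joint_comp (@continuous_expR R)); exact: cvg_fst.
Qed.

Lemma continuous_phase2 (p : R * R) :
  {for p, continuous (fun q : R * R => phase xi (w * expR q.1) th q.2)}.
Proof.
apply: cvgD; last exact: cvg_cst.
apply: cvgM; first exact: continuous_expR_fst.
by apply: cvgB; [exact: cvg_snd|exact: cvg_cst].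
Qed.

Lemma continuous_amplitude : continuous amplitude.
Proof.
move=> s.
have ? : is_derive s 1 amplitude (amplitude s * (sigma ^+ 2 / 2 * (w * expR s) ^+ 2)).
  by apply: is_derive_eq; rewrite /GRing.scale /amplitude /=; field.
exact: is_derive_continuous.
Qed.

Lemma continuous_amplitude_fst (p : R * R) :
  {for p, continuous (fun q : R * R => amplitude q.1)}.
Proof. by apply: (joint_comp continuous_amplitude); exact: cvg_fst. Qed.

Lemma continuous_wave2 (p : R * R) : {for p, continuous (fun q : R * R => wave q.1 q.2)}.
Proof.
apply: cvgM; first exact: continuous_amplitude_fst.
by apply: (joint_comp (@continuous_cos R)); exact: continuous_phase2.
Qed.

Lemma continuous_wave_t2 (p : R * R) : {for p, continuous (fun q : R * R => wave_t q.1 q.2)}.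
Proof.
apply: cvgM; first exact: continuous_amplitude_fst.
apply: cvgB; apply: cvgM.
- apply: cvgM; first exact: cvg_cst.
  by apply: (joint_comp (@exprn_continuous _ 2)); exact: continuous_expR_fst.
- by apply: (joint_comp (@continuous_cos R)); exact: continuous_phase2.
- apply: cvgM; first exact: continuous_expR_fst.
  by apply: cvgB; [exact: cvg_snd|exact: cvg_cst].
- by apply: (joint_comp (@continuous_sin R)); exact: continuous_phase2.
Qed.

Lemma continuous_wave (s : R) : continuous (wave s).
Proof. by move=> u; apply: is_derive_continuous; exact: is_derive_wave_u. Qed.

Lemma amplitude_ge0 (s : R) : 0 <= amplitude s.
Proof. exact: expR_ge0. Qed.

Lemma freq_le (s T : R) : s <= T -> `|w * expR s| <= `|w| * expR T.
Proof.
by move=> sT; rewrite normrM [`|expR s|]ger0_norm ?expR_ge0// ler_wpM2l// ler_expR.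
Qed.

Lemma amplitude_le (s T : R) : s <= T -> amplitude s <= amplitude T.
Proof.
move=> sT; rewrite ler_expR ler_wpM2l//; first by rewrite divr_ge0// sqr_ge0.
rewrite -real_normK ?num_real// -[leRHS]real_normK ?num_real// lerXn2r ?nnegrE//.
by apply: le_trans (freq_le sT) _; rewrite normrM [`|expR T|]ger0_norm ?expR_ge0.
Qed.

Lemma wave_le (s u : R) : `|wave s u| <= amplitude s.
Proof.
by rewrite normrM ger0_norm ?amplitude_ge0// ler_piMr ?amplitude_ge0// cos_norm_le1.
Qed.

Lemma wave_u_le (s u : R) : `|wave_u s u| <= amplitude s * `|w * expR s|.
Proof.
rewrite normrN normrM normrM [`|amplitude s|]ger0_norm ?amplitude_ge0//.
by rewrite ler_piMr ?mulr_ge0 ?amplitude_ge0// sin_norm_le1.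
Qed.

Lemma taper_error_le (r s T u : R) : 1 <= r -> s <= T -> `|u - xi| <= r ->
  `|taper_error r s u| <=
  amplitude T * (4 * (1 + `|xi|) + 4 * sigma ^+ 2 + 4 * sigma ^+ 2 * (`|w| * expR T)) / r
   * (1 + `|u|).
Proof.
move=> r1 sT ur; have r0 : 0 < r by lra.
have s20 : 0 <= sigma ^+ 2 by exact: sqr_ge0.
have A0 := amplitude_ge0 T.
have wT : `|wave s u| <= amplitude T by apply: le_trans (wave_le _ _) (amplitude_le sT).
have wuT : `|wave_u s u| <= amplitude T * (`|w| * expR T).
  apply: (le_trans (wave_u_le s u)); apply: ler_pM => //.
  - exact: amplitude_ge0.
  - exact: amplitude_le.
  - exact: freq_le.
have t1 := taper1_le r0 ur; have t2 := taper2_le r1 ur; have vt1 := sub_taper1_le r0 ur.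
have ri0 : 0 <= r^-1 by rewrite invr_ge0 ltW.
have u1 := weight_ge1 u.
apply: le_trans (ler_normD _ _) _.
have -> : amplitude T * (4 * (1 + `|xi|) + 4 * sigma ^+ 2 + 4 * sigma ^+ 2 * (`|w| * expR T)) / r
   * (1 + `|u|) = amplitude T * (4 / r * ((1 + `|xi|) * (1 + `|u|))
      + sigma ^+ 2 / 2 * (8 / r) * (1 + `|u|))
   + sigma ^+ 2 * (amplitude T * (`|w| * expR T)) * (4 / r) * (1 + `|u|).
  by field; rewrite gt_eqF.
apply: lerD.
  rewrite normrM; apply: ler_pM => //.
  apply: le_trans (ler_normD _ _) _; rewrite normrN; apply: lerD.
    apply: le_trans vt1 _; apply: ler_wpM2l; first by rewrite divr_ge0// ltW.
    exact: dist_le_weight.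
  rewrite normrM (ger0_norm (_ : 0 <= sigma ^+ 2 / 2)); last by rewrite divr_ge0.
  apply: (@le_trans _ _ (sigma ^+ 2 / 2 * (8 / r))).
    by apply: ler_wpM2l => //; rewrite divr_ge0.
  by rewrite ler_peMr// mulr_ge0// divr_ge0// ltW.
apply: (@le_trans _ _ (sigma ^+ 2 * (amplitude T * (`|w| * expR T)) * (4 / r))).
  rewrite normrM; apply: ler_pM => //.
  by rewrite normrM (ger0_norm s20) ler_wpM2l.
have aw0 : 0 <= amplitude T * (`|w| * expR T) by rewrite mulr_ge0// mulr_ge0 ?expR_ge0.
by rewrite ler_peMr// mulr_ge0 ?(mulr_ge0 s20 aw0)// divr_ge0// ltW.
Qed.

End DualWave.

(** * Evolution of the cosine transform of a solution *)

Section Evolution.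
Context {R : realType}.
Local Notation mu := (@lebesgue_measure R).
Local Notation nneg t := (within [set s : R | 0 <= s] (nbhs t)).
Variables (sigma xi : R) (G : R -> R) (rho : R -> R -> R).
Hypothesis sigma_gt0 : 0 < sigma.
Hypothesis sol : zeroth_mode_solution sigma G xi rho.
Local Notation a := (derive1 G xi).
Local Notation dF := (dMaxwellian sigma xi).
Local Notation window r := (`[(xi - r)%R, (xi + r)%R]%classic).

Let rhoC : weighted_L1_continuous rho. Proof. by have [] := sol. Qed.
Let rho_wint (t : R) : 0 <= t -> wint (rho t).
Proof. exact: wint_time. Qed.

Definition solution_t (t u : R) : R := derive1 (fun s => rho s u) t.
Definition solution_u (t u : R) : R := derive1 (rho t) u.
Definition solution_uu (t u : R) : R := derive1n 2 (rho t) u.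

Lemma is_derive_solution (t u : R) : 0 < t ->
  [/\ is_derive t 1 (rho ^~ u) (solution_t t u),
      is_derive u 1 (rho t) (solution_u t u) &
      is_derive u 1 (solution_u t) (solution_uu t u)].
Proof.
move=> t0; have [C _ _] := sol; have [[d1 d2 d3] _] := C t u t0.
split.
- by rewrite /solution_t derive1E; exact: derivableP d1.
- by rewrite /solution_u derive1E; exact: derivableP d2.
- rewrite /solution_uu -[derive1n 2 _ u]/(derive1 (derive1 (rho t)) u) derive1E.
  exact: derivableP d3.
Qed.

Lemma continuous_solution (t u : R) : 0 < t ->
  [/\ {for (t, u), continuous (fun p : R * R => rho p.1 p.2)},
      {for (t, u), continuous (fun p : R * R => solution_t p.1 p.2)} &
      {for u, continuous (solution_uu t)}].
Proof.
move=> t0; have [C _ _] := sol; have [_ [c1 c2 c3]] := C t u t0.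
split; [|exact: c1|exact: (continuous_slice c3)].
apply: (@joint_continuity _ rho solution_t t u t0 _ c1) => [s v s0|].
  by have [] := is_derive_solution v s0.
have [_ d _] := is_derive_solution u t0; exact: is_derive_continuous d.
Qed.

Lemma solution_equation (t u : R) : 0 < t ->
  solution_t t u = rho t u - (xi - u) * solution_u t u + sigma ^+ 2 / 2 * solution_uu t u
    - a * first_moment (rho t) * dF u.
Proof.
move=> t0; have [_ _ E] := sol; have := E t u t0.
rewrite /zeroth_mode_equation -/(solution_t t u) -/(solution_uu t u) derive1_Maxwellian//.
have [_ d _] := is_derive_solution u t0.
have dd : is_derive u 1 (fun v => (xi - v) * rho t v) ((xi - u) * solution_u t u - rho t u).
  by apply: is_derive_eq; rewrite /GRing.scale /=; ring.
rewrite (derive1E (fun v => (xi - v) * rho t v)) (@derive_val _ _ _ _ _ _ _ dd) => ->.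
by field.
Qed.

Section FixedWindow.
Variables (w th r : R).
Hypothesis r_ge1 : 1 <= r.
Let r0 : 0 < r. Proof. exact: lt_le_trans r_ge1. Qed.
Let rn0 : r != 0. Proof. by rewrite gt_eqF. Qed.
Local Notation phi := (twave sigma xi w th r).
Local Notation err := (taper_error sigma xi w th r).

(** Differentiation under the integral is legitimate here because the
    derivatives of a solution are bounded on compact sets. *)
Definition windowed (s : R) : R := (\int[mu]_(u in window r) (rho s u * phi s u))%R.

Lemma continuous_taper : continuous (taper xi r).
Proof. by move=> u; apply: is_derive_continuous; exact: is_derive_taper. Qed.

Lemma continuous_twave (s : R) : continuous (phi s).
Proof. by move=> u; apply: is_derive_continuous; exact: is_derive_twave_u. Qed.

(** Differentiate under the integral, insert the equation, and move the
    operator onto the tapered wave with Green's formula. *)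
Lemma is_derive_windowed (s : R) : 0 < s ->
  is_derive s 1 windowed
    (\int[mu]_(u in window r) (rho s u * err s u)
     - a * first_moment (rho s) * \int[mu]_(u in window r) (dF u * phi s u))%R.
Proof.
move=> s0.
have csnd (g : R -> R) (p : R * R) : continuous g -> {for p, continuous (fun q : R * R => g q.2)}.
  by move=> cg; apply: (joint_comp cg); exact: cvg_snd.
pose dp (t u : R) := solution_t t u * phi t u + rho t u * twave_t sigma xi w th r t u.
have D : is_derive s 1 windowed (\int[mu]_(u in window r) dp s u)%R.
  apply: (@is_derive_interval_integral _ (fun t u => rho t u * phi t u) dp) => //.
  - move=> t u t0; have [d _ _] := is_derive_solution u t0.
    have ? := is_derive_twave_t sigma xi w th r t u.
    by apply: is_derive_eq; rewrite /dp /GRing.scale /=; ring.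
  - move=> t t0 u; have [_ d _] := is_derive_solution u t0.
    by apply: cvgM; [exact: is_derive_continuous d|exact: continuous_twave].
  - move=> t u t0; have [c1 c2 _] := continuous_solution u t0.
    apply: cvgD; apply: cvgM => //; apply: cvgM.
    + exact: continuous_wave2.
    + exact: (csnd _ (t, u) continuous_taper).
    + exact: continuous_wave_t2.
    + exact: (csnd _ (t, u) continuous_taper).
apply: is_derive_eq D _.
have ci (g : R -> R) : continuous g -> mu.-integrable (window r) (EFin \o g).
  move=> cg; apply: continuous_compact_integrable; first exact: segment_compact.
  exact: continuous_subspaceT.
have ru : continuous (rho s).
  by move=> u; have [_ d _] := is_derive_solution u s0; exact: is_derive_continuous d.
have ruu : continuous (solution_u s).
  by move=> u; have [_ _ d] := is_derive_solution u s0; exact: is_derive_continuous d.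
have ruuu : continuous (solution_uu s).
  by move=> u; have [_ _ c] := continuous_solution u s0.
have cphi := @continuous_twave s.
have cphiu : continuous (twave_u sigma xi w th r s).
  by move=> u; apply: is_derive_continuous; exact: is_derive_twave_uu.
have ctaper2 : continuous (taper2 xi r) by exact: continuous_taper2.
have cwave : continuous (wave sigma xi w th s) by exact: continuous_wave.
have cwave_u : continuous (wave_u sigma xi w th s).
  by move=> u; apply: is_derive_continuous; exact: is_derive_wave_uu.
have ctaper1 : continuous (taper1 xi r).
  by move=> u; apply: is_derive_continuous; exact: is_derive_taper1.
have cphiuu : continuous (twave_uu sigma xi w th r s).
  move=> u; apply: cvgD; last by apply: cvgM; [exact: cwave|exact: ctaper2].
  apply: cvgD.
    apply: cvgM; last exact: continuous_taper.
    by apply: cvgN; apply: cvgM; [exact: cvg_cst|exact: cwave].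
  apply: cvgM; last exact: ctaper1.
  by apply: cvgM; [exact: cvg_cst|exact: cwave_u].
have cphit : continuous (twave_t sigma xi w th r s).
  move=> u; apply: cvgM; last exact: continuous_taper.
  apply: (@continuous_slice _ (fun p => wave_t sigma xi w th p.1 p.2) s u).
  exact: continuous_wave_t2.
have cxi : continuous (fun u : R => xi - u).
  by move=> u; apply: cvgB; [exact: cvg_cst|exact: cvg_id].
pose k : R := sigma ^+ 2 / 2.
have cFP : continuous (fun u => (rho s u - (xi - u) * solution_u s u + k * solution_uu s u) * phi s u).
  move=> u; apply: cvgM; last exact: cphi.
  apply: cvgD; last by apply: cvgM; [exact: cvg_cst|exact: ruuu].
  apply: cvgB; first exact: ru.
  by apply: cvgM; [exact: cxi|exact: ruu].
have cdF : continuous (fun u => dF u * phi s u).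
  by move=> u; apply: cvgM; [exact: continuous_dMaxwellian|exact: cphi].
have crt : continuous (fun u => rho s u * twave_t sigma xi w th r s u).
  by move=> u; apply: cvgM; [exact: ru|exact: cphit].
have cdual : continuous (fun u => rho s u * ((xi - u) * twave_u sigma xi w th r s u
     + k * twave_uu sigma xi w th r s u)).
  move=> u; apply: cvgM; first exact: ru.
  apply: cvgD; first by apply: cvgM; [exact: cxi|exact: cphiu].
  by apply: cvgM; [exact: cvg_cst|exact: cphiuu].
pose m := a * first_moment (rho s).
transitivity (\int[mu]_(u in window r) ((rho s u - (xi - u) * solution_u s u + k * solution_uu s u) * phi s u)
  - \int[mu]_(u in window r) (m * (dF u * phi s u)) +
  \int[mu]_(u in window r) (rho s u * twave_t sigma xi w th r s u))%R.
  have ci3 : mu.-integrable (window r) (EFin \o (fun u => m * (dF u * phi s u))).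
    exact: (integrableZl _ m (ci _ cdF)).
  rewrite -RintegralB//; last exact: ci.
  rewrite -RintegralD//; last 2 first.
  - exact: (integrableB _ (ci _ cFP) ci3).
  - exact: ci.
  apply: eq_Rintegral => u _; rewrite /dp solution_equation// /m /k; ring.
have ab : xi - r < xi + r by rewrite ltrD2l gtrN.
have [pa pa1] := taper_edge (xi := xi) rn0 (or_introl erefl).
have [pb pb1] := taper_edge (xi := xi) rn0 (or_intror erefl).
have p_a : phi s (xi - r) = 0 by rewrite /twave pa mulr0.
have p_b : phi s (xi + r) = 0 by rewrite /twave pb mulr0.
have p_a1 : twave_u sigma xi w th r s (xi - r) = 0 by rewrite /twave_u pa pa1 !mulr0 addr0.
have p_b1 : twave_u sigma xi w th r s (xi + r) = 0 by rewrite /twave_u pb pb1 !mulr0 addr0.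
have d1 (u : R) : is_derive u 1 (rho s) (solution_u s u) by have [] := is_derive_solution u s0.
have d2 (u : R) : is_derive u 1 (solution_u s) (solution_uu s u).
  by have [] := is_derive_solution u s0.
rewrite (Green_formula xi k ab d1 d2 (fun u => is_derive_twave_u sigma xi w th r0 s u)
  (fun u => is_derive_twave_uu sigma xi w th r0 s u) ruuu cphiuu p_a p_b p_a1 p_b1).
rewrite addrAC -RintegralD//; [|exact: ci|exact: ci].
rewrite RintegralZl//; last exact: ci.
congr (_ - _); apply: eq_Rintegral => u _.
by rewrite -dual_equation -/k; ring.
Qed.

Lemma continuous_taper_error (s : R) : continuous (err s).
Proof.
have ct1 : continuous (taper1 xi r).
  by move=> u; apply: is_derive_continuous; exact: is_derive_taper1.
have cwu : continuous (wave_u sigma xi w th s).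
  by move=> u; apply: is_derive_continuous; exact: is_derive_wave_uu.
move=> u; apply: cvgD.
  apply: cvgM; first exact: continuous_wave.
  apply: cvgD; last by apply: cvgM; [exact: cvg_cst|exact: continuous_taper2].
  by apply: cvgN; apply: cvgM; [exact: continuous_sub|exact: ct1].
by apply: cvgM; [apply: cvgM; [exact: cvg_cst|exact: cwu]|exact: ct1].
Qed.

Lemma taper_le1 (u : R) : `|u - xi| <= r -> `|taper xi r u| <= 1.
Proof.
move=> /(window_ratio r0)[y /andP[y0 y1] [_ yE]]; rewrite /taper yE.
have z1 : 0 <= y ^+ 2 <= 1 by rewrite sqr_ge0/= expr2; nra.
by rewrite ger0_norm ?sqr_ge0// expr2; nra.
Qed.

Lemma windowed_continuous (T : R) : {within `[0, T], continuous windowed}.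
Proof.
apply: nneg_cvg_within => t t0.
pose h (s : R) := (phi s) \_ (window r).
have WE : windowed = (fun s => \int[mu]_u (rho s u * h s u))%R.
  apply/funext => s; rewrite /windowed Rintegral_mkcond; apply: eq_Rintegral => u _.
  by rewrite /h !patchE; case: ifP => //; rewrite mulr0.
rewrite WE.
pose delta (s : R) := `|amplitude sigma w s - amplitude sigma w t|
  + amplitude sigma w t * (`|w * expR s - w * expR t| * (1 + `|xi|)).
apply: (pairing_cvg rhoC (delta := delta) (K := amplitude sigma w t)) => //.
- move=> s; apply/measurable_restrict => //; rewrite setTI.
  by apply: measurable_funTS; apply: continuous_measurable_fun; exact: continuous_twave.
- apply: bounded_weight => u; rewrite /h patchE; case: ifPn.
    rewrite inE in_window => ur; rewrite normrM -[leRHS]mulr1.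
    by apply: ler_pM => //; [exact: wave_le|exact: taper_le1].
  by rewrite normr0 amplitude_ge0.
- move=> s u s0; rewrite /h !patchE; case: ifPn => [|_]; last first.
    rewrite subrr normr0 mulr_ge0 ?(ltW (weight_gt0 u))// addr_ge0//.
    by rewrite mulr_ge0 ?amplitude_ge0// mulr_ge0.
  rewrite inE in_window => ur; rewrite -mulrBl normrM -[leRHS]mulr1.
  apply: ler_pM => //; last exact: taper_le1.
  rewrite /wave; set cs := cos _; set ct := cos _.
  have -> : amplitude sigma w s * cs - amplitude sigma w t * ct =
    (amplitude sigma w s - amplitude sigma w t) * cs + amplitude sigma w t * (cs - ct) by ring.
  rewrite /delta [leRHS]mulrDl.
  apply: le_trans (ler_normD _ _) _; apply: lerD; rewrite normrM.
    apply: ler_pM => //; exact: le_trans (cos_norm_le1 _) (weight_ge1 u).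
  rewrite (ger0_norm (amplitude_ge0 _ _ _)) -mulrA ler_wpM2l ?amplitude_ge0//.
  apply: le_trans (cos_lipschitz _ _) _.
  have -> : phase xi (w * expR s) th u - phase xi (w * expR t) th u =
    (w * expR s - w * expR t) * (u - xi) by rewrite /phase; ring.
  by rewrite normrM -mulrA ler_wpM2l// dist_le_weight.
- have : delta s @[s --> t] --> delta t.
    apply: cvgD.
      apply: cvg_norm; apply: cvgB; last exact: cvg_cst.
      exact: continuous_amplitude.
    apply: cvgM; first exact: cvg_cst.
    apply: cvgM; last exact: cvg_cst.
    apply: cvg_norm; apply: cvgB; last exact: cvg_cst.
    by apply: cvgM; [exact: cvg_cst|exact: continuous_expR].
  by rewrite /delta !subrr normr0 mul0r mulr0 addr0; exact: cvg_within_filter.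
Qed.

Lemma windowed_approx (s : R) : 0 <= s ->
  `|windowed s - amplitude sigma w s * cos_transform xi (rho s) (w * expR s) th| <=
    2 * amplitude sigma w s * (1 + `|xi|) / r * wnorm (rho s).
Proof.
move=> s0.
have := taper_approx xi r0 (rho_wint s0) (@continuous_wave _ sigma xi w th s)
  (@wave_le _ sigma xi w th s).
congr (`|_ - _| <= _).
rewrite /cos_transform -RintegralZl//; last exact/cos_phase_integrable/rho_wint.
by apply: eq_Rintegral => u _; rewrite /wave; ring.
Qed.

(** The wave cancels the Gaussian in the transform of [F'], so that the source
    enters with the pure exponential weight [e^s]. *)
Lemma source_approx (s T : R) : s <= T ->
  `|\int[mu]_(u in window r) (dF u * phi s u) - w * expR s * sin th| <=
    2 * amplitude sigma w T * (1 + `|xi|) / r * wnorm dF.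
Proof.
move=> sT.
have bw u : `|wave sigma xi w th s u| <= amplitude sigma w T.
  exact: le_trans (wave_le _ _ _ _ _ _) (amplitude_le _ _ sT).
have := taper_approx xi r0 (wint_dMaxwellian xi sigma_gt0)
  (@continuous_wave _ sigma xi w th s) bw.
congr (`|_ - _| <= _).
transitivity (amplitude sigma w s * cos_transform xi dF (w * expR s) th).
  rewrite /cos_transform -RintegralZl//; last exact/cos_phase_integrable/wint_dMaxwellian.
  by apply: eq_Rintegral => u _; rewrite /wave; ring.
transitivity (amplitude sigma w s * expR (- (sigma ^+ 2 * (w * expR s) ^+ 2 / 4))
    * (w * expR s * sin th)).
  by rewrite cos_transform_dMaxwellian//; ring.
rewrite /amplitude -expRD.
by rewrite (_ : _ + _ = 0) ?expR0 ?mul1r//; field.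
Qed.

End FixedWindow.

(** The windowed identity has a time derivative of size [O(1 / r)] after
    subtracting the source, and the taper costs another [O(1 / r)] at both end
    times; hence the two sides differ by [O(1 / r)] for every [r]. *)
Lemma transform_evolution (P : R -> R) (w th T : R) : 0 <= T -> P 0 = 0 ->
  (forall t : R, 0 <= t -> is_derive t 1 P (first_moment (rho t) * expR t)) ->
  amplitude sigma w T * cos_transform xi (rho T) (w * expR T) th
    + a * sin th * w * P T
  = amplitude sigma w 0 * cos_transform xi (rho 0) w th.
Proof.
move=> T0 P0 dP.
pose A (s : R) := amplitude sigma w s.
pose E (s : R) := A s * cos_transform xi (rho s) (w * expR s) th.
have [N NP] := wnorm_bounded rhoC T.
have AT0 : 0 <= A T by exact: amplitude_ge0.
have N0 : 0 <= N by apply: le_trans (wnorm_ge0 (rho T)) (NP _ _); rewrite T0 lexx.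
(* C1 bounds the taper error, C2 the error in the source, C3 the taper error at
   an end time, all multiplied by r. *)
pose C1 := A T * (4 * (1 + `|xi|) + 4 * sigma ^+ 2 + 4 * sigma ^+ 2 * (`|w| * expR T)) * N.
pose C2 := `|a| * N * (2 * A T * (1 + `|xi|) * wnorm dF).
pose C3 := 2 * A T * (1 + `|xi|) * N.
suff : `|E T + a * sin th * w * P T - E 0| <= 0.
  rewrite normr_le0 subr_eq0 => /eqP.
  by rewrite /E expR0 mulr1.
apply: (@ge0_small _ _ ((C1 + C2) * T + C3 + C3)) => r r1.
have r0 : 0 < r by lra.
have ri0 : 0 <= r^-1 by rewrite invr_ge0 ltW.
pose H (s : R) := windowed w th r s + a * sin th * w * P s.
have cP : {within `[0, T], continuous P}.
  apply: continuous_in_subspaceT => t; rewrite inE/= in_itv/= => /andP[t0 _].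
  exact: is_derive_continuous (dP t t0).
have cH : {within `[0, T], continuous H}.
  move=> t; apply: cvgD; first exact: windowed_continuous.
  by apply: cvgM; [exact: cvg_cst|exact: cP].
pose dH (s : R) := (\int[mu]_(u in window r) (rho s u * taper_error sigma xi w th r s u)
     - a * first_moment (rho s) *
       (\int[mu]_(u in window r) (dF u * twave sigma xi w th r s u) - w * expR s * sin th))%R.
have dHP (s : R) : 0 < s < T -> is_derive s 1 H (dH s).
  move=> /andP[s0 sT]; have ? := is_derive_windowed w th r1 s0.
  have ? := dP s (ltW s0).
  by apply: is_derive_eq; rewrite /dH /GRing.scale /=; ring.
have dHle (s : R) : 0 < s < T -> `|dH s| <= (C1 + C2) / r.
  move=> /andP[s0 sT].
  have Ns : wnorm (rho s) <= N by apply: NP; rewrite !ltW.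
  rewrite mulrDl; apply: le_trans (ler_normB _ _) _; apply: lerD.
    have K0 : 0 <= A T * (4 * (1 + `|xi|) + 4 * sigma ^+ 2
        + 4 * sigma ^+ 2 * (`|w| * expR T)) / r.
      have x0 : 0 <= 4 * (1 + `|xi|) by rewrite mulr_ge0// addr_ge0.
      have k0 : 0 <= 4 * sigma ^+ 2 by rewrite mulr_ge0// sqr_ge0.
      have w0 : 0 <= `|w| * expR T by rewrite mulr_ge0// expR_ge0.
      by rewrite mulr_ge0// mulr_ge0// addr_ge0 ?(mulr_ge0 k0 w0)// addr_ge0.
    rewrite /C1 [leRHS]mulrAC.
    apply: (le_trans (window_pairing_le K0 (rho_wint (ltW s0)) _ _)).
    - exact: continuous_taper_error.
    - by move=> u; apply: taper_error_le => //; exact: ltW.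
    - exact: ler_wpM2l.
  rewrite normrM normrM /C2 -[leRHS]mulrA.
  apply: ler_pM => //.
    by rewrite ler_wpM2l//; apply: le_trans Ns; exact/first_moment_le/rho_wint/ltW.
  by apply: le_trans (source_approx w th r1 (ltW sT)) _; rewrite mulrAC.
have HH := MVT_le T0 dHP cH dHle.
have eT := windowed_approx w th r1 T0.
have e0 := windowed_approx w th r1 (lexx (0 : R)).
have HE : H T - H 0 = windowed w th r T + a * sin th * w * P T - windowed w th r 0.
  by rewrite /H P0 mulr0 addr0.
have telescope (eT' e0' W W0 c : R) : eT' + c - e0' = (W + c - W0) - (W - eT') + (W0 - e0').
  by ring.
rewrite (telescope _ _ (windowed w th r T) (windowed w th r 0)) -HE.
have -> : ((C1 + C2) * T + C3 + C3) / r = (C1 + C2) / r * T + C3 / r + C3 / r.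
  by field; rewrite gt_eqF.
have edge (s : R) : 0 <= s <= T ->
    2 * amplitude sigma w s * (1 + `|xi|) / r * wnorm (rho s) <= C3 / r.
  move=> sT; rewrite /C3 [leRHS]mulrAC; apply: ler_pM; [|exact: wnorm_ge0| |exact: NP].
    by rewrite !mulr_ge0 ?amplitude_ge0// addr_ge0.
  rewrite ler_wpM2r// ler_wpM2r ?addr_ge0// ler_wpM2l//.
  by apply: amplitude_le; case/andP: sT.
apply: le_trans (ler_normD _ _) _; apply: lerD.
  apply: le_trans (ler_normB _ _) _; apply: lerD.
    by apply: le_trans HH _; rewrite subr0.
  by apply: le_trans eT _; apply: edge; rewrite T0 lexx.
by apply: le_trans e0 _; apply: edge; rewrite T0 lexx.
Qed.

End Evolution.

(** * Evolution of the first moment *)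

(** Multiplying by the integrating factor, [e^(- a t) P - D / (1 - a) e^((1 -
    a) t)] is nonincreasing and is nonpositive at 0. The same holds for [- P].
    *)
Lemma linear_growth_le {R : realType} (a D : R) (P g : R -> R) : a < 1 -> P 0 = 0 ->
  (forall t : R, 0 <= t -> is_derive t 1 P (a * P t + g t)) ->
  (forall t : R, 0 <= t -> `|g t| <= D * expR t) ->
  forall t, 0 <= t -> `|P t| <= D / (1 - a) * expR t.
Proof.
move=> a1 P0 dP gD.
have a0 : 0 < 1 - a by rewrite subr_gt0.
have D0 : 0 <= D by have := le_trans (normr_ge0 _) (gD 0 (lexx _)); rewrite expR0 mulr1.
have one_sided (Q q : R -> R) : Q 0 = 0 ->
    (forall t : R, 0 <= t -> is_derive t 1 Q (a * Q t + q t)) ->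
    (forall t : R, 0 <= t -> q t <= D * expR t) ->
    forall t, 0 <= t -> Q t <= D / (1 - a) * expR t.
  move=> Q0 dQ qD t t0.
  pose y (s : R) := expR (- a * s) * Q s - D / (1 - a) * expR ((1 - a) * s).
  have dy (s : R) : 0 <= s -> is_derive s 1 y (expR (- a * s) * (q s - D * expR s)).
    move=> s0; have ? := dQ s s0.
    apply: is_derive_eq; rewrite /GRing.scale /=.
    have -> : expR ((1 - a) * s) = expR (- a * s) * expR s.
      by rewrite -expRD; congr expR; ring.
    by field; rewrite gt_eqF.
  have dy1 (s : R) : s \in `]0, t[%R -> derivable y s 1.
    by rewrite in_itv/= => /andP[/ltW s0 _]; have ? := dy s s0; exact: ex_derive.
  have dy_le0 (s : R) : s \in `]0, t[%R -> derive1 y s <= 0.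
    rewrite in_itv/= => /andP[/ltW s0 _]; rewrite derive1E.
    have -> := @derive_val _ _ _ _ _ _ _ (dy s s0).
    by rewrite pmulr_rle0 ?expR_gt0// subr_le0; exact: qD.
  have cy : {within `[0, t], continuous y}.
    apply: continuous_in_subspaceT => s; rewrite inE/= in_itv/= => /andP[s0 _].
    exact: is_derive_continuous (dy s s0).
  have : y t <= y 0.
    by apply: (ler0_derive1_le_cc dy1 dy_le0 cy); rewrite ?in_itv/= ?lexx ?t0.
  have y0 : y 0 <= 0.
    by rewrite /y Q0 !mulr0 sub0r expR0 mulr1 oppr_le0 divr_ge0// ltW.
  move=> /le_trans/(_ y0); rewrite /y subr_le0.
  have -> : expR ((1 - a) * t) = expR (- a * t) * expR t.
    by rewrite -expRD; congr expR; ring.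
  by rewrite mulrCA ler_pM2l ?expR_gt0.
move=> t t0; rewrite ler_norml; apply/andP; split.
  rewrite lerNl; apply: (one_sided (fun s => - P s) (fun s => - g s)) => //.
  - by rewrite P0 oppr0.
  - by move=> s s0; have ? := dP s s0; apply: is_derive_eq; ring.
  - by move=> s s0; apply: le_trans (gD s s0); rewrite -normrN ler_norm.
apply: (one_sided _ g) => // s s0; exact: le_trans (ler_norm _) (gD s s0).
Qed.

Section MeanEvolution.
Context {R : realType}.
Local Notation mu := (@lebesgue_measure R).
Local Notation nneg t := (within [set s : R | 0 <= s] (nbhs t)).
Variables (sigma xi : R) (G : R -> R) (rho : R -> R -> R).
Hypothesis sigma_gt0 : 0 < sigma.
Hypothesis sol : zeroth_mode_solution sigma G xi rho.
Local Notation a := (derive1 G xi).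
Local Notation m := (fun t => first_moment (rho t)).

Let rhoC : weighted_L1_continuous rho. Proof. by have [] := sol. Qed.
Let rho_wint (t : R) : 0 <= t -> wint (rho t).
Proof. exact: wint_time. Qed.

Lemma first_moment_cvg (t : R) : 0 <= t -> m s @[s --> nneg t] --> m t.
Proof.
move=> t0; have mE s : m s = (\int[mu]_u (rho s u * u))%R.
  by apply: eq_Rintegral => u _; rewrite mulrC.
under eq_fun do rewrite mE.
rewrite mE; apply: (@pairing_cvg _ rho rhoC (fun _ u => u) (cst 0) 1 t t0) => //.
- by move=> u; rewrite mul1r lerDr.
- by move=> s u _; rewrite subrr normr0 mul0r.
- exact: cvg_cst.
Qed.

(** Solutions are meaningful for nonnegative times only; freezing the moment at
    time 0 for negative times gives a function on the line that has a
    primitive. *)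
Lemma source_continuous : continuous (fun s : R => m (Num.max s 0) * expR s).
Proof.
move=> t; apply: cvgM; last exact: continuous_expR.
have mt0 : 0 <= Num.max t 0 by rewrite le_max lexx orbT.
have cmax : (fun s : R => Num.max s 0) @ t --> nneg (Num.max t 0).
  move=> A; rewrite /within /= => NA.
  have cm : (fun s : R => Num.max s 0) @ t --> Num.max t 0.
    exact: (@continuous_max R _ id (cst 0) t (@cvg_id _ _) (cvg_cst _)).
  have : \forall s \near t, 0 <= Num.max s 0 -> A (Num.max s 0) by exact: cm NA.
  by apply: filterS => s; apply; rewrite le_max lexx orbT.
exact: (cvg_comp _ _ cmax (first_moment_cvg mt0)).
Qed.

(** The impulse [P] accumulates the source along a characteristic. *)
Lemma impulse_exists : exists2 P : R -> R, P 0 = 0 &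
  forall t : R, 0 <= t -> is_derive t 1 P (m t * expR t).
Proof.
have [P P0 dP] := primitive_exists source_continuous.
by exists P => // t t0; have := dP t t0; rewrite max_l.
Qed.

Variable P : R -> R.
Hypothesis P0 : P 0 = 0.
Hypothesis dP : forall t : R, 0 <= t -> is_derive t 1 P (m t * expR t).

Let M : R := (\int[mu]_u rho 0 u)%R.

(** The evolution identity at frequency 0 and phase 0. *)
Lemma mass_conserved (t : R) : 0 <= t -> (\int[mu]_u rho t u)%R = M.
Proof.
move=> t0; have := transform_evolution sigma_gt0 sol 0 0 t0 P0 dP.
by rewrite /amplitude !mul0r sin0 !mulr0 !mul0r addr0 expr0n mulr0 expR0 !mul1r !cos_transform00.
Qed.

(** The evolution identity with phase [- pi / 2] vanishes at frequency 0; this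
    is its derivative there. *)
Lemma first_moment_evolution (t : R) : 0 <= t ->
  expR t * (m t - xi * M) = m 0 - xi * M + a * P t.
Proof.
move=> t0.
have dw : is_derive (0 : R) 1 (fun w => w * expR t) (expR t).
  by apply: is_derive_eq; rewrite /GRing.scale /=; ring.
have dbw (c : R) : is_derive (0 : R) 1 (fun w => c * w) c.
  by apply: is_derive_eq; rewrite /GRing.scale /=; ring.
have [b bE] : exists b : R, a = b by exists a.
have ev w : amplitude sigma w t * cos_transform xi (rho t) (w * expR t) (- (pi / 2)) - b * P t * w =
    amplitude sigma w 0 * cos_transform xi (rho 0) w (- (pi / 2)).
  rewrite -(transform_evolution sigma_gt0 sol w (- (pi / 2)) t0 P0 dP) bE.
  by rewrite sinN sin_pihalf; ring.
have A1 s : amplitude sigma 0 s = 1.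
  by rewrite /amplitude mul0r expr0n mulr0 expR0.
have dA (s : R) : is_derive (0 : R) 1 (fun w => amplitude sigma w s) 0.
  by apply: is_derive_eq; rewrite /GRing.scale /=; ring.
have [dt d0] := (is_derive_cos_transform0 xi (rho_wint t0),
  is_derive_cos_transform0 xi (rho_wint (lexx 0))).
rewrite mass_conserved// in dt.
have C0 (f : R -> R) : cos_transform xi f 0 (- (pi / 2)) = 0.
  rewrite /cos_transform; under eq_Rintegral do
    rewrite /phase mul0r add0r cosN cos_pihalf mulr0.
  by rewrite Rintegral_cst// mul0r.
have dl : is_derive (0 : R) 1
    (fun w => amplitude sigma w t * cos_transform xi (rho t) (w * expR t) (- (pi / 2)) - b * P t * w)
    (expR t * (m t - xi * M) - b * P t).
  have dt' : is_derive (0 * expR t) 1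
    (fun w => cos_transform xi (rho t) w (- (pi / 2))) (m t - xi * M) by rewrite mul0r.
  have dc : is_derive (0 : R) 1 (fun w => cos_transform xi (rho t) (w * expR t) (- (pi / 2)))
    (expR t * (m t - xi * M)).
    rewrite [expR t * _]mulrC.
    exact: (@is_derive1_comp _ (fun w => cos_transform xi (rho t) w (- (pi / 2)))
      (fun w => w * expR t) 0 _ _ dt' dw).
  have H := is_deriveB (is_deriveM (dA t) dc) (dbw (b * P t)).
  by move: H => /is_derive_eq; apply; rewrite /GRing.scale /= mul0r C0 A1; ring.
have dr : is_derive (0 : R) 1 (fun w => amplitude sigma w 0 * cos_transform xi (rho 0) w (- (pi / 2)))
    (m 0 - xi * M).
  by move: (is_deriveM (dA 0) d0) => /is_derive_eq; apply; rewrite /GRing.scale /= C0 A1 -/M; ring.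
move: dl; under eq_fun do rewrite ev.
by move=> /is_derive_uniq /(_ dr) <-; rewrite bE; ring.
Qed.

Lemma impulse_le (t : R) : a < 1 -> 0 <= t ->
  `|P t| <= (`|xi * M| + `|m 0 - xi * M|) / (1 - a) * expR t.
Proof.
move=> a1 t0.
apply: (@linear_growth_le _ a _ P (fun s => xi * M * expR s + (m 0 - xi * M))) => //.
  move=> s s0; apply: is_derive_eq (dP s0) _.
  have := first_moment_evolution s0; rewrite mulrBr => e; lra.
move=> s s0; apply: le_trans (ler_normD _ _) _.
rewrite normrM (ger0_norm (expR_ge0 _)) mulrDl lerD// ler_peMr//.
by rewrite -[leLHS]expR0 ler_expR.
Qed.

End MeanEvolution.

(** * The Fourier norm of a real function *)

Section FourierNorm.
Context {R : realType}.
Local Notation mu := (@lebesgue_measure R).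
Local Open Scope complex_scope.

Definition fcos (f : R -> R) (eta : R) : R := (\int[mu]_u (f u * cos (eta * u)))%R.
Definition fsin (f : R -> R) (eta : R) : R := (\int[mu]_u (f u * sin (eta * u)))%R.

Lemma fcosE (xi : R) (f : R -> R) (eta : R) : fcos f eta = cos_transform xi f eta (eta * xi).
Proof.
by apply: eq_Rintegral => u _; rewrite /phase; congr (_ * cos _); ring.
Qed.

Lemma fsinE (xi : R) (f : R -> R) (eta : R) :
  fsin f eta = cos_transform xi f eta (eta * xi - pi / 2).
Proof.
apply: eq_Rintegral => u _; rewrite sin_cos_shift /phase; congr (_ * cos _); ring.
Qed.

Lemma normc_fourier (f : R -> R) (eta : R) :
  ComplexField.Normc.normc (fourier f eta) = Num.sqrt (fcos f eta ^+ 2 + fsin f eta ^+ 2).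
Proof. by rewrite /fourier /= sqrrN. Qed.

Lemma sqrt_sumsq_le (x y : R) : Num.sqrt (x ^+ 2 + y ^+ 2) <= `|x| + `|y|.
Proof.
rewrite -[leRHS]ger0_norm ?addr_ge0// -sqrtr_sqr ler_wsqrtr//.
rewrite -[x ^+ 2]real_normK ?num_real// -[y ^+ 2]real_normK ?num_real//.
have := mulr_ge0 (normr_ge0 x) (normr_ge0 y); nra.
Qed.

Lemma le_sqrt_sumsq (x y : R) : `|x| <= Num.sqrt (x ^+ 2 + y ^+ 2).
Proof. by rewrite -sqrtr_sqr ler_wsqrtr// lerDl sqr_ge0. Qed.

Lemma is_derive_fcos_wint (f : R -> R) (eta : R) : wint f ->
  exists2 d : R, is_derive eta 1 (fcos f) d & `|d| <= wnorm f.
Proof.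
move=> fi; exists (- (\int[mu]_u (f u * ((u - 0) * sin (phase 0 eta 0 u)))))%R.
  have -> : fcos f = (fun w => cos_transform 0 f w 0).
    by apply/funext => w; rewrite (fcosE 0) mulr0.
  exact: is_derive_cos_transform.
rewrite normrN -[leRHS]mul1r; apply: wintM_le => //.
  apply: continuous_measurable_fun => u; apply: cvgM; first exact: continuous_sub.
  exact: continuous_sin_phase.
move=> u; rewrite normrM subr0 mul1r; apply: (@le_trans _ _ `|u|); last by rewrite lerDr.
by rewrite ler_piMr// sin_norm_le1.
Qed.

Lemma is_derive_fsin_wint (f : R -> R) (eta : R) : wint f ->
  exists2 d : R, is_derive eta 1 (fsin f) d & `|d| <= wnorm f.
Proof.
move=> fi; exists (- (\int[mu]_u (f u * ((u - 0) * sin (phase 0 eta (- (pi / 2)) u)))))%R.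
  have -> : fsin f = (fun w => cos_transform 0 f w (- (pi / 2))).
    by apply/funext => w; rewrite (fsinE 0) mulr0 add0r.
  exact: is_derive_cos_transform.
rewrite normrN -[leRHS]mul1r; apply: wintM_le => //.
  apply: continuous_measurable_fun => u; apply: cvgM; first exact: continuous_sub.
  exact: continuous_sin_phase.
move=> u; rewrite normrM subr0 mul1r; apply: (@le_trans _ _ `|u|); last by rewrite lerDr.
by rewrite ler_piMr// sin_norm_le1.
Qed.

Lemma continuous_fcos (f : R -> R) : wint f -> continuous (fcos f).
Proof.
by move=> fi eta; have [d H _] := is_derive_fcos_wint eta fi; exact: is_derive_continuous H.
Qed.

Lemma continuous_fsin (f : R -> R) : wint f -> continuous (fsin f).
Proof.
by move=> fi eta; have [d H _] := is_derive_fsin_wint eta fi; exact: is_derive_continuous H.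
Qed.

Lemma continuous_normc_fourier (f : R -> R) : wint f ->
  continuous (fun eta => ComplexField.Normc.normc (fourier f eta)).
Proof.
move=> fi eta; under eq_fun do rewrite normc_fourier.
apply: (@continuous_comp _ _ _ (fun eta => fcos f eta ^+ 2 + fsin f eta ^+ 2) (@Num.sqrt R));
  last exact: sqrt_continuous.
apply: cvgD.
- apply: (@continuous_comp _ _ _ (fcos f) (fun x => x ^+ 2)); last exact: exprn_continuous.
  exact: continuous_fcos.
- apply: (@continuous_comp _ _ _ (fsin f) (fun x => x ^+ 2)); last exact: exprn_continuous.
  exact: continuous_fsin.
Qed.

(** The essential supremum norm is defined to be 0 on a null space, so
    positivity has to be recorded. *)
Lemma lebesgue_setT_gt0 : (0 < mu [set: R])%E.
Proof.
apply: (@lt_le_trans _ _ (mu `[(0 : R), 1%R])).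
  by rewrite lebesgue_measure_itv/= lte_fin ltr01 sube0 lte_fin.
by apply: le_measure; rewrite ?inE.
Qed.

Lemma cLnorm1E (f : R -> R) :
  cLnorm 1 (fourier f) = (\int[mu]_eta (ComplexField.Normc.normc (fourier f eta))%:E)%E.
Proof.
rewrite /cLnorm Lnorm1; apply: eq_integral => eta _ /=.
by rewrite ger0_norm// sqrtr_ge0.
Qed.

Lemma cLnormy_le (h : R -> R[i]) (B : R) :
  (forall eta, ComplexField.Normc.normc (h eta) <= B) -> (cLnorm +oo h <= B%:E)%E.
Proof.
move=> hB; rewrite /cLnorm unlock lebesgue_setT_gt0.
apply/ess_supP; apply: nearW => eta /=; rewrite lee_fin ger0_norm//.
by case: (h eta) => x y; rewrite /= sqrtr_ge0.
Qed.

Lemma fourier_norm_le (f : R -> R) (A : \bar R) (B L : R) : wint f ->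
  (forall eta, `|fcos f eta| <= B) -> (forall eta, `|fsin f eta| <= B) ->
  (forall eta : R, exists2 d : R, is_derive eta 1 (fcos f) d & `|d| <= L) ->
  (forall eta : R, exists2 d : R, is_derive eta 1 (fsin f) d & `|d| <= L) ->
  (\int[mu]_eta (ComplexField.Normc.normc (fourier f eta))%:E <= A)%E ->
  (fourier_norm f <= A + (B + B)%:E + (L + L)%:E)%E.
Proof.
move=> fi cB sB dc ds IA; rewrite /fourier_norm.
apply: leeD; first apply: leeD.
- by rewrite cLnorm1E.
- apply: cLnormy_le => eta; rewrite normc_fourier.
  by apply: le_trans (sqrt_sumsq_le _ _) _; exact: lerD.
- apply: cLnormy_le => eta /=.
  have [c Dc cL] := dc eta; have [s Ds sL] := ds eta.
  have -> : derive1 (fun x => complex.Re (fourier f x)) eta = c.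
    rewrite -[LHS]/(derive1 (fcos f) eta) derive1E.
    exact: (@derive_val _ _ _ _ _ _ _ Dc).
  have -> : derive1 (fun x => complex.Im (fourier f x)) eta = - s.
    have Ds' : is_derive eta 1 (fun x => - fsin f x) (- s) by exact: is_deriveN.
    rewrite -[LHS]/(derive1 (fun x => - fsin f x) eta) derive1E.
    exact: (@derive_val _ _ _ _ _ _ _ Ds').
  by apply: le_trans (sqrt_sumsq_le _ _) _; rewrite normrN; exact: lerD.
Qed.

Lemma integral_dilation (g : R -> R) (k : R) : 0 < k -> continuous g ->
  (forall x, 0 <= g x) ->
  (\int[mu]_x (g x)%:E = k%:E * \int[mu]_x (g (x * k))%:E)%E.
Proof.
move=> k0 cg g0.
have dk (x : R) : is_derive x 1 (fun x => x * k) k.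
  by apply: is_derive_eq; rewrite /GRing.scale /=; ring.
have dkE : derive1 (fun x : R => x * k) = cst k.
  by apply/funext => x; rewrite derive1E; exact: (@derive_val _ _ _ _ _ _ _ (dk x)).
have cgk : continuous (fun x : R => g (x * k)).
  move=> x; apply: (@continuous_comp R R R (fun x : R => x * k) g); last exact: cg.
  by apply: cvgM; [exact: cvg_id|exact: cvg_cst].
have ik : {homo (fun x : R => x * k) : x y / x < y} by move=> x y xy; rewrite ltr_pM2r.
have cdk : continuous (derive1 (fun x : R => x * k)) by rewrite dkE; exact: cst_continuous.
have cvgNy : cvg (derive1 (fun x : R => x * k) x @[x --> -oo]).
  by rewrite dkE; apply/cvg_ex; exists k; exact: cvg_cst.
have cvgy : cvg (derive1 (fun x : R => x * k) x @[x --> +oo]).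
  by rewrite dkE; apply/cvg_ex; exists k; exact: cvg_cst.
have ddk (x : R) : derivable (fun x : R => x * k) x 1.
  by have ? := dk x; exact: ex_derive.
have FNy : (x * k) @[x --> -oo] --> -oo by exact: (gt0_cvgMlNy k0 (@cvg_id _ _)).
have Fy : (x * k) @[x --> +oo] --> +oo by exact: (gt0_cvgMly k0 (@cvg_id _ _)).
rewrite (increasing_ge0_integration_by_substitutionT ik cdk cvgNy cvgy ddk FNy Fy cg g0).
rewrite dkE -ge0_integralZl//.
- by apply: eq_integral => x _; rewrite /= /GRing.mul /= EFinM muleC.
- by apply/measurable_EFinP; exact: (continuous_measurable_fun cgk).
- by move=> x _; rewrite lee_fin.
- by rewrite lee_fin ltW.
Qed.

End FourierNorm.

(** * Uniform bounds on the transform of a solution *)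

Section GaussianFactors.
Context {R : realType}.
Implicit Types kappa eta : R.

Definition gauss kappa eta : R := expR (- (kappa * eta ^+ 2)).

Lemma gauss_ge0 kappa eta : 0 <= gauss kappa eta. Proof. exact: expR_ge0. Qed.

Lemma gauss_le kappa kappa' eta : kappa <= kappa' -> gauss kappa' eta <= gauss kappa eta.
Proof. by move=> kk; rewrite ler_expR lerN2 ler_wpM2r// sqr_ge0. Qed.

Lemma gauss_le1 kappa eta : 0 <= kappa -> gauss kappa eta <= 1.
Proof. by move=> k0; rewrite -[leRHS]expR0 ler_expR oppr_le0 mulr_ge0// sqr_ge0. Qed.

Lemma gauss_absorb kappa eta : 0 <= kappa -> (1 + kappa * eta ^+ 2) * gauss kappa eta <= 1.
Proof.
by move=> k0; rewrite /gauss expRN ler_pdivrMr ?expR_gt0// mul1r expR_ge1Dx.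
Qed.

Lemma continuous_gauss kappa : continuous (gauss kappa).
Proof.
move=> eta; apply: (@is_derive_continuous _ _ _ (- (2 * kappa * eta) * gauss kappa eta)).
by apply: is_derive_eq; rewrite /gauss /GRing.scale /=; ring.
Qed.

Lemma is_derive_gauss kappa eta :
  is_derive eta 1 (gauss kappa) (- (2 * kappa * eta) * gauss kappa eta).
Proof. by apply: is_derive_eq; rewrite /gauss /GRing.scale /=; ring. Qed.

Lemma is_derive_mul_gauss kappa eta :
  is_derive eta 1 (fun x => x * gauss kappa x) ((1 - 2 * kappa * eta ^+ 2) * gauss kappa eta).
Proof.
have ? := is_derive_gauss kappa eta.
by apply: is_derive_eq; rewrite /GRing.scale /=; ring.
Qed.

Lemma gauss_slope_le kappa eta : 0 <= kappa ->
  `|- (2 * kappa * eta) * gauss kappa eta| <= kappa + 1.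
Proof.
move=> k0; have g1 := gauss_absorb eta k0; have g0 := gauss_ge0 kappa eta.
have gl := gauss_le1 eta k0.
rewrite normrM normrN (ger0_norm g0) !normrM normr_nat (ger0_norm k0).
have e2 : 2 * `|eta| <= 1 + eta ^+ 2.
  rewrite -[eta ^+ 2]real_normK ?num_real// -subr_ge0.
  have -> : 1 + `|eta| ^+ 2 - 2 * `|eta| = (1 - `|eta|) ^+ 2 by ring.
  exact: sqr_ge0.
apply: (@le_trans _ _ (kappa * (1 + eta ^+ 2) * gauss kappa eta)).
  by rewrite ler_wpM2r// mulrAC mulrC ler_wpM2l.
have -> : kappa * (1 + eta ^+ 2) * gauss kappa eta =
  kappa * gauss kappa eta + kappa * eta ^+ 2 * gauss kappa eta by ring.
apply: lerD; first by rewrite ler_piMr.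
by apply: le_trans g1; rewrite mulrDl mul1r lerDr.
Qed.

Lemma mul_gauss_slope_le kappa eta : 0 <= kappa ->
  `|(1 - 2 * kappa * eta ^+ 2) * gauss kappa eta| <= 2.
Proof.
move=> k0; have g1 := gauss_absorb eta k0; have g0 := gauss_ge0 kappa eta.
have z0 : 0 <= kappa * eta ^+ 2 by rewrite mulr_ge0// sqr_ge0.
rewrite normrM (ger0_norm g0).
apply: (@le_trans _ _ (2 * ((1 + kappa * eta ^+ 2) * gauss kappa eta))).
  rewrite mulrA ler_wpM2r// ler_norml; apply/andP; split; lra.
by rewrite -[leRHS]mulr1 ler_wpM2l.
Qed.

(** Half of the exponent absorbs the linear factor; the half that remains is
    integrable. *)
Lemma mul_gauss_le kappa eta : 0 < kappa ->
  `|eta * gauss kappa eta| <= (1 + 2 / kappa) * gauss (kappa / 2) eta.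
Proof.
move=> k0; have k20 : 0 <= kappa / 2 by rewrite divr_ge0// ltW.
have g1 := gauss_absorb eta k20; have g0 := gauss_ge0 (kappa / 2) eta.
have -> : gauss kappa eta = gauss (kappa / 2) eta * gauss (kappa / 2) eta.
  by rewrite /gauss -expRD; congr expR; field.
rewrite mulrA normrM (ger0_norm g0) ler_wpM2r// normrM (ger0_norm g0).
have e2 : `|eta| <= 1 + eta ^+ 2.
  rewrite -[eta ^+ 2]real_normK ?num_real//; have := normr_ge0 eta; nra.
have i0 : 0 <= 2 / kappa by rewrite divr_ge0// ltW.
apply: (@le_trans _ _ ((1 + 2 / kappa) * ((1 + kappa / 2 * eta ^+ 2) * gauss (kappa / 2) eta))).
  rewrite mulrA ler_wpM2r//; apply: le_trans e2 _.
  have z0 : 0 <= kappa / 2 * eta ^+ 2 by rewrite mulr_ge0// sqr_ge0.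
  have e : (1 + 2 / kappa) * (1 + kappa / 2 * eta ^+ 2) =
    1 + eta ^+ 2 + 2 / kappa + kappa / 2 * eta ^+ 2 by field; rewrite gt_eqF.
  by rewrite e; lra.
by rewrite -[leRHS]mulr1 ler_wpM2l// addr_ge0.
Qed.

End GaussianFactors.

Section SolutionFormula.
Context {R : realType}.
Local Notation mu := (@lebesgue_measure R).
Variables (sigma xi : R) (G : R -> R) (rho : R -> R -> R).
Hypothesis sigma_gt0 : 0 < sigma.
Hypothesis sol : zeroth_mode_solution sigma G xi rho.
Local Notation a := (derive1 G xi).
Variable P : R -> R.
Hypothesis P0 : P 0 = 0.
Hypothesis dP : forall t : R, 0 <= t -> is_derive t 1 P (first_moment (rho t) * expR t).

Let rhoC : weighted_L1_continuous rho. Proof. by have [] := sol. Qed.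
Let rho0_wint : wint (rho 0). Proof. exact: wint_time. Qed.

Local Notation kappa0 := (sigma ^+ 2 / 4).
(** The damping rate accumulated along a characteristic up to time [t]; it is
    nonnegative, bounded by [sigma^2 / 4], and bounded below for [t >= 1]. *)
Definition diffusion (t : R) : R := sigma ^+ 2 / 4 * (1 - expR (- t) ^+ 2).
Local Notation shifted t := (xi - xi * expR t).

(** The evolution identity at the frequency [eta e^(- t)] that is transported
    to [eta]. Recentring the initial transform at [xi - xi e^t] absorbs the
    phase [eta xi], so that the phase [th] no longer depends on [eta]. *)
Lemma solution_formula (t eta th : R) : 0 <= t ->
  cos_transform xi (rho t) eta (eta * xi + th) =
    gauss (diffusion t) eta * cos_transform (shifted t) (rho 0) (eta * expR (- t)) th
    - (a * (P t * expR (- t))) * (sin (eta * xi + th) * (eta * gauss kappa0 eta)).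
Proof.
move=> t0; pose w := eta * expR (- t).
have ee : expR (- t) * expR t = 1 by rewrite -expRD addNr expR0.
have wt : w * expR t = eta by rewrite /w -mulrA ee mulr1.
have := transform_evolution sigma_gt0 sol w (eta * xi + th) t0 P0 dP.
have -> : cos_transform xi (rho 0) w (eta * xi + th) = cos_transform (shifted t) (rho 0) w th.
  apply: eq_Rintegral => u _; congr (_ * cos _); rewrite /phase -wt; ring.
rewrite /amplitude wt expR0 mulr1.
set Ct := cos_transform xi (rho t) _ _; set C0 := cos_transform _ (rho 0) _ _ => e.
have [b bE] : exists b : R, a = b by exists a.
move: e; rewrite bE => e.
have e1 : Ct = gauss kappa0 eta * (expR (kappa0 * eta ^+ 2) * Ct).
  by rewrite mulrA /gauss -expRD addNr expR0 mul1r.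
have e2 : gauss (diffusion t) eta = gauss kappa0 eta * expR (kappa0 * w ^+ 2).
  by rewrite /gauss -expRD /diffusion /w; congr expR; field.
rewrite e1 e2; have -> : expR (kappa0 * eta ^+ 2) * Ct = expR (kappa0 * w ^+ 2) * C0
  - b * sin (eta * xi + th) * w * P t by rewrite -e; ring.
by rewrite /w; ring.
Qed.

Variables (B : R).
Hypothesis B_ge0 : 0 <= B.
Hypothesis PB : forall t : R, 0 <= t -> `|a * (P t * expR (- t))| <= B.

Lemma diffusion_ge0 (t : R) : 0 <= t -> 0 <= diffusion t.
Proof.
move=> t0; have e1 : expR (- t) <= 1 by rewrite -[leRHS]expR0 ler_expR oppr_le0.
have e0 := expR_ge0 (- t).
rewrite mulr_ge0 ?divr_ge0 ?sqr_ge0// subr_ge0 expr2; nra.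
Qed.

Lemma diffusion_le (t : R) : diffusion t <= kappa0.
Proof.
rewrite /diffusion ler_piMr ?divr_ge0 ?sqr_ge0// gerBl; exact: sqr_ge0.
Qed.

(** The recentred variable, once contracted, is [e^(- t) (u - xi) + xi], which
    grows at most linearly uniformly in [t]. *)
Lemma shifted_distance (t u : R) : 0 <= t ->
  `|expR (- t) * (u - shifted t)| <= (1 + 2 * `|xi|) * (1 + `|u|).
Proof.
move=> t0; have e1 : expR (- t) <= 1 by rewrite -[leRHS]expR0 ler_expR oppr_le0.
have -> : expR (- t) * (u - shifted t) = expR (- t) * (u - xi) + xi.
  have ee : expR (- t) * expR t = 1 by rewrite -expRD addNr expR0.
  have -> : expR (- t) * (u - shifted t) =
    expR (- t) * (u - xi) + xi * (expR (- t) * expR t) by ring.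
  by rewrite ee mulr1.
have h1 : `|expR (- t) * (u - xi)| <= `|u| + `|xi|.
  rewrite normrM (ger0_norm (expR_ge0 _)).
  by apply: le_trans (ler_normB u xi); rewrite ler_piMl.
apply: le_trans (ler_normD _ _) _.
have := normr_ge0 u; have := normr_ge0 xi; nra.
Qed.

Lemma is_derive_shifted (t eta th : R) : 0 <= t ->
  exists2 d : R, is_derive eta 1
    (fun eta => cos_transform (shifted t) (rho 0) (eta * expR (- t)) th) d &
    `|d| <= (1 + 2 * `|xi|) * wnorm (rho 0).
Proof.
move=> t0; set s := shifted t; set k := expR (- t).
pose I := (\int[mu]_u (rho 0 u * ((u - s) * sin (phase s (eta * k) th u))))%R.
exists (- I * k).
  have dk : is_derive eta 1 (fun eta => eta * k) k.
    by apply: is_derive_eq; rewrite /GRing.scale /=; ring.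
  exact: (@is_derive1_comp _ (fun w => cos_transform s (rho 0) w th) (fun w => w * k) eta _ _
    (is_derive_cos_transform s (eta * k) th rho0_wint) dk).
have ms : measurable_fun setT (fun u : R => (u - s) * sin (phase s (eta * k) th u)).
  apply: continuous_measurable_fun => u; apply: cvgM; first exact: continuous_sub.
  exact: continuous_sin_phase.
rewrite mulNr normrN mulrC /I -RintegralZl//; last first.
  apply: (@wintM _ _ _ (1 + `|s|)) => // u.
  by rewrite normrM -[leRHS]mulr1 ler_pM// ?dist_le_weight// sin_norm_le1.
under eq_Rintegral do rewrite mulrCA.
apply: wintM_le => //; first exact: measurable_funM.
move=> u; rewrite mulrA normrM -[leRHS]mulr1 ler_pM//; last exact: sin_norm_le1.
exact: shifted_distance.
Qed.

Definition component_bound : R := wnorm (rho 0) + B * (1 + 2 / kappa0).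
Definition slope_bound : R := (kappa0 + 1) * wnorm (rho 0) + (1 + 2 * `|xi|) * wnorm (rho 0)
  + B * (`|xi| * (1 + 2 / kappa0) + 2).

Let kappa0_gt0 : 0 < kappa0. Proof. by rewrite divr_gt0// exprn_gt0. Qed.

Lemma component_le (t eta th : R) : 0 <= t ->
  `|cos_transform xi (rho t) eta (eta * xi + th)| <=
    gauss (diffusion t) eta *
      `|cos_transform (shifted t) (rho 0) (eta * expR (- t)) th|
    + B * (1 + 2 / kappa0) * gauss (kappa0 / 2) eta.
Proof.
move=> t0; rewrite solution_formula//; apply: le_trans (ler_normB _ _) _; apply: lerD.
  by rewrite normrM (ger0_norm (gauss_ge0 _ _)).
rewrite normrM -mulrA; apply: ler_pM => //; first exact: PB.
rewrite normrM -[leRHS]mul1r; apply: ler_pM => //; first exact: sin_norm_le1.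
exact: mul_gauss_le.
Qed.

Lemma component_le_bound (t eta th : R) : 0 <= t ->
  `|cos_transform xi (rho t) eta (eta * xi + th)| <= component_bound.
Proof.
move=> t0; apply: le_trans (component_le eta th t0) _; apply: lerD.
  rewrite -[leRHS]mul1r; apply: ler_pM => //; first exact: gauss_ge0.
    by apply: gauss_le1; exact: diffusion_ge0.
  exact: cos_transform_le.
rewrite ler_piMr//; last by apply: gauss_le1; rewrite divr_ge0// ltW.
by rewrite mulr_ge0// addr_ge0// divr_ge0// ltW.
Qed.

Lemma component_slope (t eta th : R) : 0 <= t ->
  exists2 d : R, is_derive eta 1
    (fun eta => cos_transform xi (rho t) eta (eta * xi + th)) d & `|d| <= slope_bound.
Proof.
move=> t0.
have -> : (fun eta => cos_transform xi (rho t) eta (eta * xi + th)) = (fun eta =>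
    gauss (diffusion t) eta * cos_transform (shifted t) (rho 0) (eta * expR (- t)) th
    - (a * (P t * expR (- t))) * (sin (eta * xi + th) * (eta * gauss kappa0 eta))).
  by apply/funext => x; exact: solution_formula.
have [dq Dq dqle] := is_derive_shifted eta th t0.
have [b bE] : exists b : R, a * (P t * expR (- t)) = b by exists (a * (P t * expR (- t))).
have bB : `|b| <= B by rewrite -bE; exact: PB.
rewrite bE.
set k := diffusion t; have k0 : 0 <= k by exact: diffusion_ge0.
set q := (fun eta => cos_transform (shifted t) (rho 0) (eta * expR (- t)) th) in Dq *.
have q_le : `|q eta| <= wnorm (rho 0) by exact: cos_transform_le.
have dg := is_derive_gauss k eta; have dmg := is_derive_mul_gauss kappa0 eta.
have ds : is_derive eta 1 (fun eta => sin (eta * xi + th)) (xi * cos (eta * xi + th)).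
  by apply: is_derive_eq; rewrite /GRing.scale /=; ring.
exists (- (2 * k * eta) * gauss k eta * q eta + gauss k eta * dq
  - b * (xi * cos (eta * xi + th) * (eta * gauss kappa0 eta)
       + sin (eta * xi + th) * ((1 - 2 * kappa0 * eta ^+ 2) * gauss kappa0 eta))).
  have dc := is_derive_cst b eta (1 : R).
  have H := is_deriveB (is_deriveM dg Dq) (is_deriveM dc (is_deriveM ds dmg)).
  by move: H => /is_derive_eq; apply; rewrite /GRing.scale /= /cst; ring.
rewrite /slope_bound; apply: le_trans (ler_normB _ _) _; apply: lerD.
  apply: le_trans (ler_normD _ _) _; apply: lerD.
    rewrite normrM; apply: ler_pM => //.
    apply: le_trans (gauss_slope_le _ k0) _; rewrite lerD2r; exact: diffusion_le.
  rewrite normrM -[leRHS]mul1r; apply: ler_pM => //.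
  by rewrite ger0_norm ?gauss_ge0//; exact: gauss_le1.
rewrite normrM; apply: ler_pM => //.
apply: le_trans (ler_normD _ _) _; apply: lerD.
  rewrite normrM normrM; apply: ler_pM => //.
    by rewrite -[leRHS]mulr1 ler_wpM2l// cos_norm_le1.
  apply: le_trans (mul_gauss_le _ kappa0_gt0) _.
  rewrite -[leRHS]mulr1 ler_wpM2l//; first by rewrite addr_ge0// divr_ge0// ltW.
  by apply: gauss_le1; rewrite divr_ge0// ltW.
rewrite normrM -[leRHS]mul1r; apply: ler_pM => //; first exact: sin_norm_le1.
by apply: mul_gauss_slope_le; exact: ltW.
Qed.

End SolutionFormula.

(** * Stability when the slope is below one *)

Section Stability.
Context {R : realType}.
Local Notation mu := (@lebesgue_measure R).
Local Notation normc := ComplexField.Normc.normc.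
Variables (sigma xi : R) (G : R -> R).
Hypothesis sigma_gt0 : 0 < sigma.
Local Notation a := (derive1 G xi).
Local Notation kappa0 := (sigma ^+ 2 / 4).

Lemma gauss_integral_lty (kappa : R) : 0 < kappa ->
  (\int[mu]_eta (gauss kappa eta)%:E < +oo)%E.
Proof.
move=> k0; have := integrable_lty measurableT (gauss_integrable 0 k0).
by congr (_ < _)%E; apply: eq_integral => eta _; rewrite /= subr0.
Qed.

Lemma measurable_gauss (kappa : R) : measurable_fun setT (gauss kappa).
Proof. by apply: continuous_measurable_fun; exact: continuous_gauss. Qed.

(** A phase shift is a rotation of the pair of cosine and sine integrals. *)
Lemma shifted_le_normc (f : R -> R) (c w th : R) : wint f ->
  `|cos_transform c f w th| <= 2 * normc (fourier f w).
Proof.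
move=> fi; pose d := th - w * c.
have -> : cos_transform c f w th = fcos f w * cos d - fsin f w * sin d.
  have inc : mu.-integrable setT (EFin \o (fun u => f u * cos (w * u))).
    apply: eq_integrable (cos_phase_integrable 0 w 0 fi) => // u _ /=.
    by rewrite /phase subr0 addr0.
  have ins : mu.-integrable setT (EFin \o (fun u => f u * sin (w * u))).
    apply: eq_integrable (cos_phase_integrable 0 w (- (pi / 2)) fi) => // u _ /=.
    by rewrite /phase subr0 -sin_cos_shift.
  rewrite /fcos /fsin -!RintegralZr// -RintegralB//; last 2 first.
  - exact: (integrableZr measurableT (cos d) inc).
  - exact: (integrableZr measurableT (sin d) ins).
  apply: eq_Rintegral => u _.
  have -> : phase c w th u = w * u + d by rewrite /phase /d; ring.
  by rewrite cosD; ring.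
rewrite normc_fourier mulr2n mulrDl mul1r.
apply: le_trans (ler_normB _ _) _; apply: lerD; rewrite normrM.
  apply: (@le_trans _ _ `|fcos f w|); first by rewrite ler_piMr// cos_norm_le1.
  exact: le_sqrt_sumsq.
apply: (@le_trans _ _ `|fsin f w|); first by rewrite ler_piMr// sin_norm_le1.
by rewrite addrC; exact: le_sqrt_sumsq.
Qed.

(** The suprema are controlled by [component_le_bound] and [component_slope].
    For the L^1 norm the part coming from the initial condition is dominated by
    a dilation of the initial transform when [t <= 1] and by a fixed Gaussian
    when [t >= 1]. *)
Lemma stable_of_lt1 : a < 1 -> zeroth_mode_stable sigma G xi.
Proof.
move=> a1 rho sol fin0.
have rhoC : weighted_L1_continuous rho by have [] := sol.
have [P P0 dP] := impulse_exists sol.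
pose m0 := first_moment (rho 0) : R; pose M : R := (\int[mu]_u rho 0 u)%R.
pose B := `|a| * ((`|xi * M| + `|m0 - xi * M|) / (1 - a)).
have B0 : 0 <= B.
  by rewrite mulr_ge0// divr_ge0// subr_ge0 ltW.
have PB (t : R) : 0 <= t -> `|a * (P t * expR (- t))| <= B.
  move=> t0; rewrite normrM ler_wpM2l// normrM (ger0_norm (expR_ge0 _)).
  have := impulse_le sigma_gt0 sol P0 dP a1 t0.
  by rewrite expRN ler_pdivrMr ?expR_gt0.
have w0 : wint (rho 0) by exact: wint_time.
pose N := wnorm (rho 0); have N0 : 0 <= N by exact: wnorm_ge0.
have kappa0_gt0 : 0 < kappa0 by rewrite divr_gt0// exprn_gt0.
pose kappa1 := diffusion sigma 1.
have kappa1_gt0 : 0 < kappa1.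
  rewrite mulr_gt0// subr_gt0 expr2.
  have e1 : expR (- 1) < 1 :> R by rewrite -[ltRHS]expR0 ltr_expR oppr_lt0.
  have e0 : 0 < expR (- 1) :> R by exact: expR_gt0.
  nra.
pose K := B * (1 + 2 / kappa0) + B * (1 + 2 / kappa0).
have K0 : 0 <= K by rewrite addr_ge0// mulr_ge0// addr_ge0// divr_ge0// ltW.
(* S dominates the contribution of the initial condition, T that of the source.
   *)
pose S : \bar R := ((4 * expR 1)%:E * cLnorm 1 (fourier (rho 0%R))
   + (N + N)%:E * \int[mu]_eta (gauss kappa1 eta)%:E)%E.
pose T : \bar R := (K%:E * \int[mu]_eta (gauss (kappa0 / 2) eta)%:E)%E.
have ge0L : (0 <= cLnorm 1 (fourier (rho 0%R)))%E by exact: Lnorm_ge0.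
have gI (k : R) : (0 <= \int[mu]_eta (gauss k eta)%:E)%E.
  by apply: integral_ge0 => eta _; rewrite lee_fin gauss_ge0.
have Llty : (cLnorm 1 (fourier (rho 0%R)) < +oo)%E.
  apply: le_lt_trans fin0; rewrite /fourier_norm -addeA leeDl//.
  by rewrite adde_ge0//; exact: Lnorm_ge0.
have Slty : (S < +oo)%E.
  rewrite lte_add_pinfty//.
    by rewrite lte_mul_pinfty// lee_fin mulr_ge0// expR_ge0.
  by rewrite lte_mul_pinfty// ?gauss_integral_lty// lee_fin addr_ge0.
have Tlty : (T < +oo)%E.
  by rewrite lte_mul_pinfty// ?gauss_integral_lty// ?lee_fin// divr_gt0.
pose Cb := component_bound sigma rho B.
pose Lb := slope_bound sigma xi rho B.
apply: (@le_lt_trans _ _ (S + T + (Cb + Cb)%:E + (Lb + Lb)%:E)%E); last first.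
  by rewrite lte_add_pinfty// ?ltry// lte_add_pinfty// ?ltry// lte_add_pinfty.
apply: ge_ereal_sup => _ [t t0 <-].
have wt : wint (rho t) by exact: wint_time.
apply: fourier_norm_le => //.
- move=> eta; rewrite (fcosE xi) -[eta * xi]addr0.
  exact: (component_le_bound sigma_gt0 sol P0 dP B0 PB).
- move=> eta; rewrite (fsinE xi).
  exact: (component_le_bound sigma_gt0 sol P0 dP B0 PB).
- move=> eta.
  have -> : fcos (rho t) = (fun eta => cos_transform xi (rho t) eta (eta * xi + 0)).
    by apply/funext => x; rewrite addr0 (fcosE xi).
 exact: (component_slope sigma_gt0 sol P0 dP PB eta 0 t0).
- move=> eta.
  have -> : fsin (rho t) = (fun eta => cos_transform xi (rho t) eta (eta * xi - pi / 2)).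
    by apply/funext => x; rewrite (fsinE xi).
  exact: (component_slope sigma_gt0 sol P0 dP PB eta (- (pi / 2)) t0).
pose Q (eta : R) := gauss (diffusion sigma t) eta *
   `|cos_transform (xi - xi * expR t) (rho 0) (eta * expR (- t)) 0|
   + gauss (diffusion sigma t) eta *
   `|cos_transform (xi - xi * expR t) (rho 0) (eta * expR (- t)) (- (pi / 2))|.
have pointwise (eta : R) : normc (fourier (rho t) eta) <= Q eta + K * gauss (kappa0 / 2) eta.
  rewrite normc_fourier; apply: le_trans (sqrt_sumsq_le _ _) _.
  rewrite (fcosE xi) (fsinE xi) -[X in cos_transform xi _ _ X]addr0.
  apply: le_trans (lerD (component_le sigma_gt0 sol P0 dP PB eta 0 t0)
    (component_le sigma_gt0 sol P0 dP PB eta (- (pi / 2)) t0)) _.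
  by rewrite le_eqVlt; apply/orP; left; apply/eqP; rewrite /Q /K; ring.
have mn : measurable_fun setT (fun eta => (normc (fourier (rho t) eta))%:E).
  apply/measurable_EFinP; apply: continuous_measurable_fun.
  exact: continuous_normc_fourier.
have n0 (f : R -> R) eta : 0 <= normc (fourier f eta) by rewrite normc_fourier sqrtr_ge0.
have mT : measurable_fun setT (fun eta => (K * gauss (kappa0 / 2) eta)%:E).
  by apply/measurable_EFinP; apply: measurable_funM => //; exact: measurable_gauss.
(* It remains to dominate Q by a function s of integral at most S, differently
   for small and large times. *)
have conclude (s : R -> R) : (forall eta, 0 <= s eta) -> measurable_fun setT s ->
    (forall eta, Q eta <= s eta) -> (\int[mu]_eta (s eta)%:E <= S)%E ->
    (\int[mu]_eta (normc (fourier (rho t) eta))%:E <= S + T)%E.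
  move=> s0 ms Qs sS.
  apply: (@le_trans _ _ (\int[mu]_eta ((s eta)%:E + (K * gauss (kappa0 / 2) eta)%:E))%E).
    apply: ge0_le_integral => //.
    - by move=> eta _; rewrite lee_fin.
    - by apply: emeasurable_funD => //; exact/measurable_EFinP.
    - move=> eta _; rewrite -EFinD lee_fin; apply: le_trans (pointwise eta) _.
      by rewrite lerD2r.
  rewrite ge0_integralD//; last 3 first.
  - by move=> eta _; rewrite lee_fin.
  - exact/measurable_EFinP.
  - by move=> eta _; rewrite lee_fin mulr_ge0// gauss_ge0.
  apply: leeD => //.
  under eq_integral do rewrite EFinM.
  rewrite ge0_integralZl//.
  - by apply/measurable_EFinP; exact: measurable_gauss.
  - by move=> eta _; rewrite lee_fin gauss_ge0.
have [t1|t1] := leP t 1.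
  pose s (eta : R) := 4 * normc (fourier (rho 0) (eta * expR (- t))).
  have cn : continuous (fun eta : R => normc (fourier (rho 0) (eta * expR (- t)))).
    move=> x; apply: (@continuous_comp R R R (fun x : R => x * expR (- t))
      (fun eta => normc (fourier (rho 0) eta))); last exact: continuous_normc_fourier.
    by apply: cvgM; [exact: cvg_id|exact: cvg_cst].
  have mns := continuous_measurable_fun cn.
  apply: (conclude s).
  - by move=> eta; rewrite mulr_ge0.
  - exact: measurable_funM.
  - move=> eta; rewrite /Q /s.
    have g1 : gauss (diffusion sigma t) eta <= 1 by apply: gauss_le1; exact: diffusion_ge0.
    have g0 := gauss_ge0 (diffusion sigma t) eta.
    have h th := shifted_le_normc (xi - xi * expR t) (eta * expR (- t)) th w0.
    have -> : 4 * normc (fourier (rho 0) (eta * expR (- t))) =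
      1 * (2 * normc (fourier (rho 0) (eta * expR (- t)))) +
      1 * (2 * normc (fourier (rho 0) (eta * expR (- t)))) by ring.
    by apply: lerD; apply: ler_pM => //; exact: h.
  - apply: (@le_trans _ _ ((4 * expR 1)%:E * cLnorm 1 (fourier (rho 0%R)))%E); last first.
      by rewrite leeDl// mule_ge0// lee_fin addr_ge0.
    rewrite cLnorm1E (integral_dilation (expR_gt0 (- t)) (continuous_normc_fourier w0) (n0 _)).
    rewrite muleA -EFinM -mulrA -expRD.
    under eq_integral do rewrite EFinM.
    rewrite ge0_integralZl//; last 2 first.
    + exact/measurable_EFinP.
    + by move=> eta _; rewrite lee_fin.
    apply: lee_wpmul2r; first by apply: integral_ge0 => eta _; rewrite lee_fin.
    by rewrite lee_fin ler_peMr// -[leLHS]expR0 ler_expR subr_ge0.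
apply: (conclude (fun eta => (N + N) * gauss kappa1 eta)).
- by move=> eta; rewrite mulr_ge0 ?addr_ge0// gauss_ge0.
- by apply: measurable_funM => //; exact: measurable_gauss.
- move=> eta; rewrite /Q [leRHS]mulrDl.
  have g : gauss (diffusion sigma t) eta <= gauss kappa1 eta.
    apply: gauss_le; rewrite /kappa1 /diffusion ler_wpM2l ?(ltW kappa0_gt0)// lerB// lerXn2r ?nnegrE ?expR_ge0//.
    by rewrite ler_expR lerN2 ltW.
  by apply: lerD; rewrite mulrC; apply: ler_pM => //; rewrite ?gauss_ge0//; exact: cos_transform_le.
- under eq_integral do rewrite EFinM.
  rewrite ge0_integralZl//; last 3 first.
  + by apply/measurable_EFinP; exact: measurable_gauss.
  + by move=> eta _; rewrite lee_fin gauss_ge0.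
  + by rewrite lee_fin addr_ge0.
  by rewrite leeDr// mule_ge0// lee_fin mulr_ge0// expR_ge0.
Qed.

End Stability.

(** * Instability when the slope is at least one *)

Section Instability.
Context {R : realType}.
Local Notation mu := (@lebesgue_measure R).
Local Notation normc := ComplexField.Normc.normc.
Variables (sigma xi : R) (G : R -> R).
Hypothesis sigma_gt0 : 0 < sigma.
Local Notation a := (derive1 G xi).
Local Notation F := (Maxwellian sigma xi).
Local Notation dF := (dMaxwellian sigma xi).
Local Notation kappa0 := (sigma ^+ 2 / 4).

Let sigma_neq0 : sigma != 0. Proof. by rewrite gt_eqF. Qed.

Definition d2Maxwellian (u : R) : R := (4 * (u - xi) ^+ 2 / sigma ^+ 4 - 2 / sigma ^+ 2) * F u.
Definition d3Maxwellian (u : R) : R := 8 * (u - xi) / sigma ^+ 4 * F u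
  + (4 * (u - xi) ^+ 2 / sigma ^+ 4 - 2 / sigma ^+ 2) * dF u.

Lemma is_derive_dMaxwellian (u : R) : is_derive u 1 dF (d2Maxwellian u).
Proof.
have ? := is_derive_Maxwellian xi sigma_gt0 u.
by apply: is_derive_eq; rewrite /GRing.scale /= /d2Maxwellian /dMaxwellian; field.
Qed.

Lemma is_derive_d2Maxwellian (u : R) : is_derive u 1 d2Maxwellian (d3Maxwellian u).
Proof.
have ? := is_derive_Maxwellian xi sigma_gt0 u.
by apply: is_derive_eq; rewrite /GRing.scale /= /d3Maxwellian; field.
Qed.

Lemma continuous_d2Maxwellian : continuous d2Maxwellian.
Proof. by move=> u; apply: is_derive_continuous; exact: is_derive_d2Maxwellian. Qed.

Lemma continuous_d3Maxwellian : continuous d3Maxwellian.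
Proof.
move=> u; apply: (@is_derive_continuous _ _ _
  (8 / sigma ^+ 4 * F u + 8 * (u - xi) / sigma ^+ 4 * dF u
   + (8 * (u - xi) / sigma ^+ 4 * dF u
      + (4 * (u - xi) ^+ 2 / sigma ^+ 4 - 2 / sigma ^+ 2) * d2Maxwellian u))).
have ? := is_derive_Maxwellian xi sigma_gt0 u; have ? := is_derive_dMaxwellian u.
by apply: is_derive_eq; rewrite /GRing.scale /=; field.
Qed.

Variables (alpha : R) (beta : R -> R).
(** The Fokker-Planck operator kills [F] and maps [F'] to [- F'], and [alpha F
    + beta F'] has first moment [alpha xi - beta]; this is the coefficient of
    [F'] on the right of the equation. *)
Definition beta_rate (t : R) : R := (a - 1) * beta t - a * alpha * xi.
Hypothesis dbeta : forall t : R, is_derive t 1 beta (beta_rate t).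

Definition gaussian_mode (t u : R) : R := alpha * F u + beta t * dF u.

Lemma wint_gaussian_mode (t : R) : wint (gaussian_mode t).
Proof.
by apply: wintD; apply: wintZ; [exact: wint_Maxwellian|exact: wint_dMaxwellian].
Qed.

Lemma continuous_beta : continuous beta.
Proof. by move=> t; exact: is_derive_continuous (dbeta t). Qed.

Lemma continuous_beta_rate : continuous beta_rate.
Proof.
move=> t; apply: cvgB; last exact: cvg_cst.
by apply: cvgM; [exact: cvg_cst|exact: continuous_beta].
Qed.

Lemma is_derive_gaussian_mode_t (t u : R) :
  is_derive t 1 (gaussian_mode ^~ u) (beta_rate t * dF u).
Proof.
by have ? := dbeta t; apply: is_derive_eq; rewrite /GRing.scale /=; ring.
Qed.

Lemma is_derive_gaussian_mode_u (t u : R) :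
  is_derive u 1 (gaussian_mode t) (alpha * dF u + beta t * d2Maxwellian u).
Proof.
have ? := is_derive_Maxwellian xi sigma_gt0 u; have ? := is_derive_dMaxwellian u.
by apply: is_derive_eq; rewrite /GRing.scale /=; ring.
Qed.

Lemma is_derive_gaussian_mode_uu (t u : R) :
  is_derive u 1 (fun u => alpha * dF u + beta t * d2Maxwellian u)
    (alpha * d2Maxwellian u + beta t * d3Maxwellian u).
Proof.
have ? := is_derive_dMaxwellian u; have ? := is_derive_d2Maxwellian u.
by apply: is_derive_eq; rewrite /GRing.scale /=; ring.
Qed.

Lemma derive1_of (f : R -> R) (f' : R -> R) :
  (forall x : R, is_derive x 1 f (f' x)) -> derive1 f = f'.
Proof.
move=> H; apply/funext => x; rewrite derive1E.
exact: (@derive_val _ _ _ _ _ _ _ (H x)).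
Qed.

Lemma first_moment_gaussian_mode (t : R) :
  first_moment (gaussian_mode t) = alpha * xi - beta t.
Proof.
have iF := wint_moment_integrable (wint_Maxwellian xi sigma_gt0).
have idF := wint_moment_integrable (wint_dMaxwellian xi sigma_gt0).
have e (f : R -> R) : first_moment f = (\int[mu]_u (f u * u))%R.
  by apply: eq_Rintegral => u _; rewrite mulrC.
have := first_moment_Maxwellian xi sigma_gt0.
have := first_moment_dMaxwellian xi sigma_gt0.
rewrite !e => mdF mF.
have -> : alpha * xi = alpha * (\int[mu]_u (F u * u))%R by rewrite mF.
have -> : beta t = - (beta t * (\int[mu]_u (dF u * u))%R) by rewrite mdF; ring.
rewrite opprK -!RintegralZl// -RintegralD//.
- by apply: eq_Rintegral => u _; rewrite /gaussian_mode; ring.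
- exact: (integrableZl measurableT alpha iF).
- exact: (integrableZl measurableT (beta t) idF).
Qed.

Lemma gaussian_mode_solution : zeroth_mode_solution sigma G xi gaussian_mode.
Proof.
have et (u : R) : derive1 (gaussian_mode ^~ u) = fun t => beta_rate t * dF u.
  by apply: derive1_of => t; exact: is_derive_gaussian_mode_t.
have eu (t : R) : derive1 (gaussian_mode t) = fun u => alpha * dF u + beta t * d2Maxwellian u.
  by apply: derive1_of => u; exact: is_derive_gaussian_mode_u.
have euu (t : R) : derive1n 2 (gaussian_mode t) =
    fun u => alpha * d2Maxwellian u + beta t * d3Maxwellian u.
  by rewrite /derive1n /= eu; apply: derive1_of => u; exact: is_derive_gaussian_mode_uu.
have cfst (g : R -> R) (p : R * R) : continuous g -> {for p, continuous (fun q : R * R => g q.1)}.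
  by move=> cg; apply: (joint_comp cg); exact: cvg_fst.
have csnd (g : R -> R) (p : R * R) : continuous g -> {for p, continuous (fun q : R * R => g q.2)}.
  by move=> cg; apply: (joint_comp cg); exact: cvg_snd.
have cdF : continuous dF.
  by move=> v; apply: is_derive_continuous; exact: is_derive_dMaxwellian.
split.
- move=> t u t0; split; split.
  + by have ? := is_derive_gaussian_mode_t t u; exact: ex_derive.
  + by have ? := is_derive_gaussian_mode_u t u; exact: ex_derive.
  + by rewrite eu; have ? := is_derive_gaussian_mode_uu t u; exact: ex_derive.
  + have -> : (fun p : R * R => derive1 (gaussian_mode ^~ p.2) p.1) =
        (fun p => beta_rate p.1 * dF p.2) by apply/funext => p; rewrite et.
    apply: cvgM; first exact: (cfst _ (t, u) continuous_beta_rate).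
    exact: (csnd _ (t, u) cdF).
  + have -> : (fun p : R * R => derive1 (gaussian_mode p.1) p.2) =
        (fun p => alpha * dF p.2 + beta p.1 * d2Maxwellian p.2).
      by apply/funext => p; rewrite eu.
    apply: cvgD; apply: cvgM.
    * exact: cvg_cst.
    * exact: (csnd _ (t, u) cdF).
    * exact: (cfst _ (t, u) continuous_beta).
    * exact: (csnd _ (t, u) continuous_d2Maxwellian).
  + have -> : (fun p : R * R => derive1n 2 (gaussian_mode p.1) p.2) =
        (fun p => alpha * d2Maxwellian p.2 + beta p.1 * d3Maxwellian p.2).
      by apply/funext => p; rewrite euu.
    apply: cvgD; apply: cvgM.
    * exact: cvg_cst.
    * exact: (csnd _ (t, u) continuous_d2Maxwellian).
    * exact: (cfst _ (t, u) continuous_beta).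
    * exact: (csnd _ (t, u) continuous_d3Maxwellian).
- move=> t t0; split; first exact: wint_gaussian_mode.
  have e s : (\int[mu]_u ((1 + `|u|) * `|gaussian_mode s u - gaussian_mode t u|))%R =
      `|beta s - beta t| * wnorm dF.
    rewrite -wnormZ; last exact: wint_dMaxwellian.
    by apply: eq_Rintegral => u _; rewrite /gaussian_mode; congr (_ * `|_|); ring.
  under eq_fun do rewrite e.
  apply: cvg_within_filter.
  have : `|beta s - beta t| * wnorm dF @[s --> t] --> `|beta t - beta t| * wnorm dF.
    apply: cvgM; last exact: cvg_cst.
    by apply: cvg_norm; apply: cvgB; [exact: continuous_beta|exact: cvg_cst].
  by rewrite subrr normr0 mul0r.
move=> t u t0; rewrite /zeroth_mode_equation et euu first_moment_gaussian_mode.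
rewrite derive1_Maxwellian//.
have dd : is_derive u 1 (fun v => (xi - v) * gaussian_mode t v)
   ((xi - u) * (alpha * dF u + beta t * d2Maxwellian u) - gaussian_mode t u).
  have ? := is_derive_gaussian_mode_u t u.
  by apply: is_derive_eq; rewrite /GRing.scale /=; ring.
rewrite (derive1E (fun v => (xi - v) * gaussian_mode t v)) (@derive_val _ _ _ _ _ _ _ dd).
rewrite /beta_rate /gaussian_mode /d3Maxwellian /d2Maxwellian /dMaxwellian.
have [b' ->] : exists b' : R, a = b' by exists a.
by field.
Qed.

Lemma cos_transform_gaussian_mode (t w th : R) :
  cos_transform xi (gaussian_mode t) w th =
    gauss kappa0 w * (alpha * cos th + beta t * w * sin th).
Proof.
have iF := cos_phase_integrable xi w th (wint_Maxwellian xi sigma_gt0).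
have idF := cos_phase_integrable xi w th (wint_dMaxwellian xi sigma_gt0).
transitivity (alpha * cos_transform xi F w th + beta t * cos_transform xi dF w th).
  rewrite /cos_transform -!RintegralZl// -RintegralD//.
  - by apply: eq_Rintegral => u _; rewrite /gaussian_mode; ring.
  - exact: (integrableZl measurableT alpha iF).
  - exact: (integrableZl measurableT (beta t) idF).
rewrite cos_transform_Maxwellian// cos_transform_dMaxwellian// /gauss.
rewrite (_ : kappa0 * w ^+ 2 = sigma ^+ 2 * w ^+ 2 / 4); last by ring.
by ring.
Qed.

(** The phase [eta xi] only rotates [alpha + i beta eta]. *)
Lemma normc_gaussian_mode (t eta : R) :
  normc (fourier (gaussian_mode t) eta) =
    gauss kappa0 eta * Num.sqrt (alpha ^+ 2 + (beta t * eta) ^+ 2).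
Proof.
rewrite normc_fourier (fcosE xi) (fsinE xi) !cos_transform_gaussian_mode.
rewrite cosB sinB cos_pihalf sin_pihalf !mulr0 !mulr1 add0r sub0r.
rewrite -[gauss kappa0 eta in RHS]ger0_norm ?gauss_ge0// -sqrtr_sqr -sqrtrM ?sqr_ge0//.
congr Num.sqrt.
have := cos2Dsin2 (eta * xi).
set c := cos _; set s := sin _ => cs.
have -> : gauss kappa0 eta ^+ 2 * (alpha ^+ 2 + (beta t * eta) ^+ 2) =
  gauss kappa0 eta ^+ 2 * (alpha ^+ 2 + (beta t * eta) ^+ 2) * (c ^+ 2 + s ^+ 2).
  by rewrite cs mulr1.
ring.
Qed.

Lemma fourier_norm_gaussian_mode_lty (t : R) : (fourier_norm (gaussian_mode t) < +oo)%E.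
Proof.
have wt := wint_gaussian_mode t.
have kappa0_gt0 : 0 < kappa0 by rewrite divr_gt0// exprn_gt0.
pose K := `|alpha| + `|beta t| * (1 + 2 / kappa0).
have K0 : 0 <= K by rewrite addr_ge0// mulr_ge0// addr_ge0// divr_ge0// ltW.
pose A : \bar R := (K%:E * \int[mu]_eta (gauss (kappa0 / 2) eta)%:E)%E.
have Alty : (A < +oo)%E.
  by rewrite lte_mul_pinfty// ?gauss_integral_lty// ?lee_fin// divr_gt0.
pose N := wnorm (gaussian_mode t).
apply: (@le_lt_trans _ _ (A + (N + N)%:E + (N + N)%:E)%E); last first.
  by rewrite lte_add_pinfty// ?ltry// lte_add_pinfty// ?ltry.
apply: fourier_norm_le => //.
- by move=> eta; rewrite (fcosE xi); exact: cos_transform_le.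
- by move=> eta; rewrite (fsinE xi); exact: cos_transform_le.
- by move=> eta; exact: is_derive_fcos_wint.
- by move=> eta; exact: is_derive_fsin_wint.
rewrite /A -ge0_integralZl//; last 2 first.
- by apply/measurable_EFinP; exact: measurable_gauss.
- by move=> eta _; rewrite lee_fin gauss_ge0.
apply: ge0_le_integral => //.
- by move=> eta _; rewrite lee_fin normc_fourier sqrtr_ge0.
- apply/measurable_EFinP; apply: continuous_measurable_fun.
  exact: continuous_normc_fourier.
- by apply: emeasurable_funM => //; apply/measurable_EFinP; exact: measurable_gauss.
move=> eta _; rewrite -EFinM lee_fin normc_gaussian_mode.
have g0 := gauss_ge0 kappa0 eta.
apply: le_trans (ler_wpM2l g0 (sqrt_sumsq_le _ _)) _.
rewrite mulrDr /K mulrDl; apply: lerD.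
  rewrite [leLHS]mulrC ler_wpM2l//; apply: gauss_le; lra.
have := mul_gauss_le eta kappa0_gt0.
rewrite normrM (ger0_norm g0) normrM => h.
have -> : gauss kappa0 eta * (`|beta t| * `|eta|) = `|beta t| * (`|eta| * gauss kappa0 eta) by ring.
by rewrite -[leRHS]mulrA ler_wpM2l.
Qed.

(** On frequencies between 1 and 2 the modulus is at least [|beta|] times the
    Gaussian at 2. *)
Lemma fourier_norm_gaussian_mode_ge (t : R) :
  ((`|beta t| * gauss kappa0 2)%:E <= fourier_norm (gaussian_mode t))%E.
Proof.
have wt := wint_gaussian_mode t.
apply: (@le_trans _ _ (cLnorm 1%E (fourier (gaussian_mode t)))); last first.
  by rewrite /fourier_norm -addeA leeDl// adde_ge0//; exact: Lnorm_ge0.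
rewrite cLnorm1E.
have n0 eta : (0 <= (normc (fourier (gaussian_mode t) eta))%:E)%E.
  by rewrite lee_fin normc_fourier sqrtr_ge0.
have mn : measurable_fun setT (fun eta => (normc (fourier (gaussian_mode t) eta))%:E).
  apply/measurable_EFinP; apply: continuous_measurable_fun.
  exact: continuous_normc_fourier.
pose D : set R := `[1, 2]%classic.
have mD : measurable D by exact: measurable_itv.
apply: (@le_trans _ _ (\int[mu]_(eta in D)
    (normc (fourier (gaussian_mode t) eta))%:E)%E); last first.
  by apply: ge0_subset_integral.
apply: (@le_trans _ _ (\int[mu]_(eta in D) (`|beta t| * gauss kappa0 2)%:E)%E).
  rewrite integral_cst//= /D lebesgue_measure_itv/= lte_fin ltr1n.
  by rewrite -EFinB (_ : 2 - 1 = 1 :> R) ?mule1//; lra.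
apply: ge0_le_integral => //.
- by move=> eta _; rewrite lee_fin mulr_ge0// gauss_ge0.
- exact: measurable_funTS.
move=> eta De; rewrite lee_fin normc_gaussian_mode.
move: De; rewrite /D /= in_itv/= => /andP[e1 e2].
rewrite [leLHS]mulrC; apply: ler_pM; rewrite ?gauss_ge0//.
  rewrite ler_expR lerN2 ler_wpM2l ?divr_ge0 ?sqr_ge0// lerXn2r ?nnegrE//; lra.
rewrite addrC; apply: le_trans (le_sqrt_sumsq _ _); rewrite normrM ler_peMr//.
by rewrite ger0_norm//; lra.
Qed.

Lemma not_stable_of_unbounded :
  (forall C : R, exists2 t, 0 <= t & C < `|beta t|) -> ~ zeroth_mode_stable sigma G xi.
Proof.
move=> unbounded /(_ _ gaussian_mode_solution (fourier_norm_gaussian_mode_lty 0)).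
set S := ereal_sup _ => Slty.
have ub (t : R) : 0 <= t -> ((`|beta t| * gauss kappa0 2)%:E <= S)%E.
  move=> t0; apply: le_trans (fourier_norm_gaussian_mode_ge t) _.
  by apply: ereal_sup_ubound; exists t.
have S0 : (0 <= S)%E.
  by apply: le_trans (ub 0 (lexx _)); rewrite lee_fin mulr_ge0// gauss_ge0.
have Sfin : S \is a fin_num by rewrite ge0_fin_numE.
have g0 : 0 < gauss kappa0 2 by exact: expR_gt0.
have [t t0] := unbounded (fine S / gauss kappa0 2).
rewrite ltr_pdivrMr// ltNge => /negP; apply.
by rewrite -lee_fin fineK//; exact: ub.
Qed.

End Instability.

Theorem proposition2 (R : realType) (sigma : R) (G : R -> R) (xi : R)
    (sigma_gt0 : 0 < sigma)
    (G_odd : forall x : R, G (- x) = - G x)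
    (G_smooth : smooth G)
    (xi_fix : xi = G xi)
    (nondegenerate : ~ (xi = 0 /\ derive1 G xi = 1)) :
  zeroth_mode_stable sigma G xi <-> derive1 G xi < 1.
Proof.
split; last exact: stable_of_lt1.
move=> st; rewrite ltNge; apply/negP => a1; move: st.
have [a_eq1|a_gt1] : derive1 G xi = 1 \/ 1 < derive1 G xi.
  by move: a1; rewrite le_eqVlt => /orP[/eqP <-|]; [left|right].
- have xi0 : xi != 0 by apply/eqP => xi0; apply: nondegenerate.
  apply: (@not_stable_of_unbounded _ sigma xi G sigma_gt0 1 (fun t => - xi * t)).
    by move=> t; apply: is_derive_eq; rewrite /beta_rate a_eq1 /GRing.scale /=; ring.
  move=> C; exists ((`|C| + 1) / `|xi|); first by rewrite divr_ge0.
  rewrite normrM normrN ger0_norm ?divr_ge0// mulrC divfK ?normr_eq0//.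
  by apply: le_lt_trans (ler_norm C) _; rewrite ltrDl.
- apply: (@not_stable_of_unbounded _ sigma xi G sigma_gt0 0
    (fun t => expR ((derive1 G xi - 1) * t))).
    by move=> t; apply: is_derive_eq; rewrite /beta_rate /GRing.scale /=; ring.
  have a0 : 0 < derive1 G xi - 1 by rewrite subr_gt0.
  move=> C; exists (`|C| / (derive1 G xi - 1)); first by rewrite divr_ge0// ltW.
  rewrite (ger0_norm (expR_ge0 _)) mulrC divfK ?gt_eqF//.
  apply: le_lt_trans (ler_norm C) _; apply: lt_le_trans (expR_ge1Dx _).
  by rewrite ltrDr.
Qed.
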